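(* Let $c\neq0$ be an arbitrary but fixed real number. Then a travelling wave solution, with the wave speed $c$, of $$u_{tt}+u_{xxxx}+au^+-bu^-=1\ \ (x\in\mathbb{R},\,t>0),\qquad u(x,t)\to 1/a,\ u_x(x,t)\to 0\ \text{ for } |x|\to+\infty,$$ exists for any $(a,b)$ satisfying $$a>\frac{c^4}{4},\qquad 0<b<\frac{c^4}{4}\cdot P\left(\frac{4a}{c^4}\right),$$ with $P$ given by $$P(\alpha):=\frac{675\,\alpha+125+\sqrt{125\,(18\,\alpha+5)^3}}{2916\,\alpha^2}.$$
   Context: Here $u^{\pm}=\max\{\pm u,0\}$, so $u=u^+-u^-$. A travelling wave solution with wave speed $c$ is a (classical) solution of the problem $$u_{tt}+u_{xxxx}+au^+-bu^-=1\ \ (x\in\mathbb{R},\,t>0),\qquad u(x,t)\to 1/a,\ u_x(x,t)\to 0\ \text{ for } |x|\to+\infty,$$ of the form $u(x,t)=y(x-ct)$ which is nontrivial, i.e. $y\not\equiv 1/a$; equivalently, $z=y-1/a$ is a nontrivial solution of $z^{(4)}+c^2z''+a(z+1/a)^+-b(z+1/a)^--1=0$ on $\mathbb{R}$ with $z,z'\to0$ as $|s|\to+\infty$. *)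

(* Defs.v *)
(* Stdlib reals with Coquelicot. *)
From Stdlib Require Export Reals.
From Coquelicot Require Export Coquelicot.
Open Scope R_scope.

Definition pos_part (r : R) : R := Rmax r 0.
Definition neg_part (r : R) : R := Rmax (- r) 0.

Definition d_x (k : nat) (u : R -> R -> R) (x t : R) : R :=
  Derive_n (fun x' => u x' t) k x.
Definition d_t (k : nat) (u : R -> R -> R) (x t : R) : R :=
  Derive_n (fun t' => u x t') k t.

(* Coquelicot's [Derive_n] is total, so existence of the derivatives is
   required separately; continuity is joint in (x, t). *)
Definition classical_regularity (u : R -> R -> R) : Prop :=
  forall x t : R, 0 < t ->
    (forall k : nat, (k <= 4)%nat ->
       ex_derive_n (fun x' => u x' t) k x /\ continuity_2d_pt (d_x k u) x t) /\
    (forall k : nat, (k <= 2)%nat ->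
       ex_derive_n (fun t' => u x t') k t /\ continuity_2d_pt (d_t k u) x t).

Definition lim_abs_infty (f : R -> R) (l : R) : Prop :=
  is_lim f p_infty l /\ is_lim f m_infty l.

(* [u] is only constrained on the half-plane t > 0; its values for t <= 0 are
   irrelevant. *)
Definition classical_solution (a b : R) (u : R -> R -> R) : Prop :=
  classical_regularity u /\
  (forall x t : R, 0 < t ->
     d_t 2 u x t + d_x 4 u x t
       + a * pos_part (u x t) - b * neg_part (u x t) = 1) /\
  (forall t : R, 0 < t ->
     lim_abs_infty (fun x => u x t) (1 / a) /\
     lim_abs_infty (fun x => d_x 1 u x t) 0).

Definition travelling_wave_solution (a b c : R) (u : R -> R -> R) : Prop :=
  classical_solution a b u /\
  exists y : R -> R,
    (forall x t : R, 0 < t -> u x t = y (x - c * t)) /\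
    (exists s : R, y s <> 1 / a).

Definition P (alpha : R) : R :=
  (675 * alpha + 125 + sqrt (125 * (18 * alpha + 5) ^ 3))
    / (2916 * alpha ^ 2).

(* Main.v *)
From Stdlib Require Import Lra Lia ZArith Classical IndefiniteDescription.
From mathcomp Require filter.
Require Import Defs.
Open Scope R_scope.

(** Put [sigma = c ^ 2 / 2], [kappa = a - sigma ^ 2 > 0], [k = a - b > 0] and
    [L = (D ^ 2 + sigma) ^ 2 + kappa = D ^ 4 + c ^ 2 D ^ 2 + a]. A profile
    [1 / a - theta V] solves the wave equation as soon as
    [L V = (k V - h)^+] for some [h > 0], since scaling [V] moves the level [h]
    to any other one. This freedom makes [h] available as a Lagrange
    multiplier: a minimiser of
    [1/2 |w|^2 + k/2 <v, L v> - k <w, v>] over [w >= 0] with integral [1] and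
    arbitrary [v] satisfies [L v = w] and [w = (k v - h)^+], where [h] is
    [-2] times the minimum. So it suffices that the functional take a negative
    value.

    On the line a minimising sequence may lose compactness. The minimum is
    therefore taken on a circular lattice, where it exists trivially
    ([lenergy_minimum_exists]), and the spacing is sent to zero and the length
    to infinity together. The solutions and their difference quotients up to
    order four are bounded uniformly ([lattice_uniform_bounds]), so centred at a point
    where [w > 0] they converge along an ultrafilter to a solution [V] on the
    line with [h <= k V 0] ([homoclinic_profile]). Nothing has to be said about
    the mass that escapes to infinity: every limit of this kind is a nontrivial
    profile, because its square is integrable by the energy bound, and a
    square integrable function with bounded derivatives decays together with
    its slope ([square_integrable_decay]). Quantitatively what is needed is a
    lower bound of [h], that is, a test pair of negative energy that does not
    depend on the lattice.

    The test function is a modulated wave [eta x * (beta + cos (sqrt sigma x + s))],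
    where [eta] is a bump of large width ([negative_energy_state]). The
    operator [D ^ 2 + sigma] annihilates the cosine, so the derivatives of the
    wave contribute only through [beta] and through errors that are small for a
    wide bump. On average over the phase [s] the energy is negative when
    [beta^2 b + b/2 + 3/8 (a - b) (1 - beta)^2 < sigma^2 / 2]. The best [beta]
    makes this follow from [(9 a - 5 sigma^2) b < 3 a sigma^2], which holds
    below the given curve because [(9 alpha - 5) P alpha < 3 alpha] for
    [alpha > 1] ([P_bound]). *)

(** * Limits along an ultrafilter *)

Lemma free_ultrafilter :
  exists U : (nat -> Prop) -> Prop,
    ProperFilter U /\ (forall A, U A \/ U (fun n => ~ A n)) /\
    (forall A, eventually A -> U A).
Proof.
  assert (PF : @filter.ProperFilter nat eventually).
  { constructor.
    - intros [N H]. exact (H N (Nat.le_refl N)).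
    - constructor.
      + apply filter_true.
      + intros A B. apply filter_and.
      + intros A B H. apply filter_imp. exact H. }
  destruct (@filter.ultraFilterLemma nat _ PF) as [G [UG sub]].
  pose proof (@filter.ultra_proper _ _ UG) as PG.
  pose proof (@filter.filter_filter _ _ PG) as FG.
  exists G. split; [|split].
  - constructor.
    + intros A HA. apply NNPP; intro H.
      apply (@filter.filter_not_empty _ G PG).
      revert HA; apply filter.filterS. intros x Ax. apply H. now exists x.
    + constructor.
      * apply filter.filterT.
      * intros A B; apply filter.filterI.
      * intros A B H; apply filter.filterS; exact H.
  - intros A. exact (@filter.in_ultra_setVsetC _ G A UG).
  - exact sub.
Qed.

Section Ultralimit.

Context (U : (nat -> Prop) -> Prop) {PU : ProperFilter U}.

Definition ulim (f : nat -> R) (l : R) : Prop := filterlim f U (locally l).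

Lemma ulim_iff f l :
  ulim f l <-> forall eps, 0 < eps -> U (fun n => Rabs (f n - l) < eps).
Proof.
  split.
  - intros H eps He. apply (H (fun y => Rabs (y - l) < eps)).
    exists (mkposreal eps He). intros y Hy. exact Hy.
  - intros H Q [eps He]. unfold filtermap.
    generalize (H eps (cond_pos eps)). apply filter_imp.
    intros n Hn. apply He. exact Hn.
Qed.

Lemma ulim_const c : ulim (fun _ => c) c.
Proof. apply filterlim_const. Qed.

Lemma ulim_continuous f l (g : R -> R) :
  ulim f l -> continuous g l -> ulim (fun n => g (f n)) (g l).
Proof. intros Hf Hg. exact (filterlim_comp _ _ _ f g U _ _ Hf Hg). Qed.

Lemma ulim_plus f g lf lg :
  ulim f lf -> ulim g lg -> ulim (fun n => f n + g n) (lf + lg).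
Proof.
  intros Hf Hg. exact (filterlim_comp_2 f g Rplus Hf Hg (filterlim_plus lf lg)).
Qed.

Lemma ulim_mult f g lf lg :
  ulim f lf -> ulim g lg -> ulim (fun n => f n * g n) (lf * lg).
Proof.
  intros Hf Hg.
  exact (filterlim_comp_2 f g Rmult Hf Hg (@filterlim_mult R_AbsRing lf lg)).
Qed.

Lemma ulim_opp f lf : ulim f lf -> ulim (fun n => - f n) (- lf).
Proof.
  intros Hf. apply ulim_continuous; [exact Hf|].
  exact (@filterlim_opp _ R_NormedModule lf).
Qed.

Lemma ulim_minus f g lf lg :
  ulim f lf -> ulim g lg -> ulim (fun n => f n - g n) (lf - lg).
Proof. intros Hf Hg. apply ulim_plus; [exact Hf | now apply ulim_opp]. Qed.

Lemma ulim_div f c lf : ulim f lf -> ulim (fun n => f n / c) (lf / c).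
Proof. intros Hf. apply ulim_mult; [exact Hf | apply ulim_const]. Qed.

Lemma ulim_pow f lf m : ulim f lf -> ulim (fun n => f n ^ m) (lf ^ m).
Proof.
  intros Hf; induction m as [|m IH]; simpl.
  - apply ulim_const.
  - now apply ulim_mult.
Qed.

Lemma ulim_Rabs f lf : ulim f lf -> ulim (fun n => Rabs (f n)) (Rabs lf).
Proof. intros Hf. apply ulim_continuous; [exact Hf | apply continuous_Rabs]. Qed.

Lemma ulim_Rmax0 f lf :
  ulim f lf -> ulim (fun n => Rmax (f n) 0) (Rmax lf 0).
Proof.
  intros Hf. apply ulim_iff. intros eps He.
  generalize (proj1 (ulim_iff _ _) Hf eps He). apply filter_imp.
  intros n. unfold Rmax, Rabs.
  repeat (destruct Rle_dec); repeat (destruct Rcase_abs); lra.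
Qed.

Lemma ulim_le f g lf lg :
  ulim f lf -> ulim g lg -> U (fun n => f n <= g n) -> lf <= lg.
Proof.
  intros Hf Hg H.
  destruct (Rle_lt_dec lf lg) as [|Hlt]; [assumption|exfalso].
  assert (He : 0 < (lf - lg) / 2) by lra.
  pose proof (proj1 (ulim_iff _ _) Hf _ He) as H1.
  pose proof (proj1 (ulim_iff _ _) Hg _ He) as H2.
  destruct (filter_ex _ (filter_and _ _ H (filter_and _ _ H1 H2)))
    as [n [Hn [H3 H4]]].
  apply Rabs_def2 in H3. apply Rabs_def2 in H4. lra.
Qed.

Lemma ulim_unique f l l' : ulim f l -> ulim f l' -> l = l'.
Proof.
  intros H H'. apply Rle_antisym.
  - apply (ulim_le f f); auto. apply filter_forall; intros; lra.
  - apply (ulim_le f f); auto. apply filter_forall; intros; lra.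
Qed.

Lemma ulim_ext f g l :
  U (fun n => f n = g n) -> ulim f l -> ulim g l.
Proof.
  intros H Hf. apply (filterlim_ext_loc f); assumption.
Qed.

Lemma ulim_null_bound f g :
  U (fun n => Rabs (f n) <= g n) -> ulim g 0 -> ulim f 0.
Proof.
  intros H Hg. apply ulim_iff. intros eps He.
  generalize (filter_and _ _ H (proj1 (ulim_iff _ _) Hg eps He)).
  apply filter_imp. intros n [H1 H2].
  rewrite Rminus_0_r in *. apply Rabs_def2 in H2.
  apply Rle_lt_trans with (1 := H1). lra.
Qed.

(** Along an ultrafilter each bounded sequence converges: the limit is the
    supremum of the levels that the sequence exceeds on a set of the
    ultrafilter. *)
Lemma ulim_exists (f : nat -> R) B :
  (forall A, U A \/ U (fun n => ~ A n)) ->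
  U (fun n => Rabs (f n) <= B) -> exists l, ulim f l.
Proof.
  intros ultra Hb.
  destruct (completeness (fun r => U (fun n => r <= f n))) as [l [Hub Hlub]].
  - exists B. intros r Hr.
    destruct (filter_ex _ (filter_and _ _ Hb Hr)) as [n [H1 H2]].
    apply Rabs_le_between in H1. lra.
  - exists (- B). generalize Hb. apply filter_imp. intros n H1.
    apply Rabs_le_between in H1. lra.
  - exists l. apply ulim_iff. intros eps He.
    assert (Hlow : U (fun n => l - eps < f n)).
    { destruct (classic (exists r, U (fun n => r <= f n) /\ l - eps < r))
        as [[r [Hr Hlr]]|Hno].
      - generalize Hr. apply filter_imp. intros; lra.
      - exfalso. assert (l <= l - eps); [|lra].
        apply Hlub. intros r Hr. apply Rnot_lt_le. intro Hlt.
        apply Hno. now exists r. }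
    assert (Hup : U (fun n => f n < l + eps)).
    { destruct (ultra (fun n => l + eps <= f n)) as [H|H].
      - specialize (Hub _ H). lra.
      - generalize H. apply filter_imp. intros; lra. }
    generalize (filter_and _ _ Hlow Hup). apply filter_imp.
    intros n [H1 H2]. apply Rabs_def1; lra.
Qed.

End Ultralimit.


Ltac ulim :=
  lazymatch goal with
  | |- ulim _ (fun _ => ?c) _ => refine (ulim_const _ c)
  | |- ulim _ (fun n => @?f n + @?g n) _ => refine (ulim_plus _ f g _ _ _ _); ulim
  | |- ulim _ (fun n => @?f n - @?g n) _ => refine (ulim_minus _ f g _ _ _ _); ulim
  | |- ulim _ (fun n => @?f n / ?c) _ => refine (ulim_div _ f c _ _); ulim
  | |- ulim _ (fun n => @?f n * @?g n) _ => refine (ulim_mult _ f g _ _ _ _); ulim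
  | |- ulim _ (fun n => - @?f n) _ => refine (ulim_opp _ f _ _); ulim
  | |- ulim _ (fun n => @?f n ^ ?m) _ => refine (ulim_pow _ f _ m _); ulim
  | |- ulim _ (fun n => Rabs (@?f n)) _ => refine (ulim_Rabs _ f _ _); ulim
  | |- ulim _ (fun n => Rmax (@?f n) 0) _ => refine (ulim_Rmax0 _ f _ _); ulim
  | |- _ => try assumption
  end.

Lemma ulim_lim_seq (U : (nat -> Prop) -> Prop) (f : nat -> R) (l : R) :
  (forall A, eventually A -> U A) -> is_lim_seq f l -> ulim U f l.
Proof. intros H Hf A HA. apply H. exact (Hf A HA). Qed.

(** * Difference calculus on a circular lattice *)

Fixpoint psum (f : Z -> R) (n : nat) : R :=
  match n with
  | O => 0
  | S m => psum f m + f (Z.of_nat m)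
  end.

Lemma psum_ext f g n :
  (forall i, (0 <= i < Z.of_nat n)%Z -> f i = g i) -> psum f n = psum g n.
Proof.
  induction n as [|n IH]; intros H; simpl; [reflexivity|].
  rewrite IH, H; [reflexivity | lia | intros; apply H; lia].
Qed.

Lemma psum_le f g n :
  (forall i, (0 <= i < Z.of_nat n)%Z -> f i <= g i) -> psum f n <= psum g n.
Proof.
  induction n as [|n IH]; intros H; simpl; [lra|].
  apply Rplus_le_compat; [apply IH; intros | ]; apply H; lia.
Qed.

Lemma psum_plus f g n : psum (fun i => f i + g i) n = psum f n + psum g n.
Proof. induction n as [|n IH]; simpl; [ring | rewrite IH; ring]. Qed.

Lemma psum_minus f g n : psum (fun i => f i - g i) n = psum f n - psum g n.
Proof. induction n as [|n IH]; simpl; [ring | rewrite IH; ring]. Qed.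

Lemma psum_scal c f n : psum (fun i => c * f i) n = c * psum f n.
Proof. induction n as [|n IH]; simpl; [ring | rewrite IH; ring]. Qed.

Lemma psum_const c n : psum (fun _ => c) n = INR n * c.
Proof.
  induction n as [|n IH]; [simpl; ring|].
  rewrite S_INR. simpl. rewrite IH. ring.
Qed.

Lemma psum_nonneg f n :
  (forall i, (0 <= i < Z.of_nat n)%Z -> 0 <= f i) -> 0 <= psum f n.
Proof.
  intros H. rewrite <- (Rmult_0_r (INR n)), <- psum_const. now apply psum_le.
Qed.

Lemma psum_split f m n :
  psum f (m + n) = psum f m + psum (fun i => f (i + Z.of_nat m)%Z) n.
Proof.
  induction n as [|n IH]; simpl.
  - rewrite Nat.add_0_r. ring.
  - rewrite Nat.add_succ_r. simpl. rewrite IH.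
    replace (Z.of_nat (m + n)) with (Z.of_nat n + Z.of_nat m)%Z by lia. ring.
Qed.

Lemma psum_mono f m n :
  (forall i, 0 <= f i) -> (m <= n)%nat -> psum f m <= psum f n.
Proof.
  intros H Hmn. replace n with (m + (n - m))%nat by lia.
  rewrite psum_split.
  pose proof (psum_nonneg (fun i => f (i + Z.of_nat m)%Z) (n - m)
                (fun i _ => H _)). lra.
Qed.

Lemma psum_ulim U {PU : ProperFilter U} (f : nat -> Z -> R) g n :
  (forall i, ulim U (fun m => f m i) (g i)) ->
  ulim U (fun m => psum (f m) n) (psum g n).
Proof.
  intros H. induction n as [|n IH]; simpl; ulim. apply H.
Qed.

Definition periodic (N : nat) (f : Z -> R) : Prop :=
  forall i, f (i + Z.of_nat N)%Z = f i.

Lemma psum_periodic_shift N f j :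
  periodic N f -> psum (fun i => f (i + j)%Z) N = psum f N.
Proof.
  intros Hf.
  assert (Hs : forall g, periodic N g -> psum (fun i => g (i + 1)%Z) N = psum g N).
  { intros g Hg.
    assert (H : forall n, psum (fun i => g (i + 1)%Z) n
                          = psum g n + g (Z.of_nat n) - g 0%Z).
    { induction n as [|n IH]; [simpl; ring|].
      cbn [psum]. rewrite IH.
      replace (Z.of_nat n + 1)%Z with (Z.of_nat (S n)) by lia. ring. }
    rewrite H. rewrite <- (Hg 0%Z). simpl. ring. }
  assert (Hp : forall j, periodic N (fun i => f (i + j)%Z)).
  { intros l i. rewrite <- (Hf (i + l)%Z). f_equal. lia. }
  revert j. apply Z.peano_ind.
  - apply psum_ext. intros. f_equal. lia.
  - intros j IH. rewrite <- IH, <- (Hs _ (Hp j)).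
    apply psum_ext. intros. f_equal. lia.
  - intros j IH. rewrite <- IH, <- (Hs _ (Hp (Z.pred j))).
    apply psum_ext. intros. f_equal. lia.
Qed.

Lemma psum_periodic_term N f j :
  (0 < N)%nat -> periodic N f -> (forall i, 0 <= f i) -> f j <= psum f N.
Proof.
  intros HN Hf H. rewrite <- (psum_periodic_shift N f j Hf).
  replace N with (1 + (N - 1))%nat by lia.
  rewrite psum_split. cbn [psum Nat.add].
  pose proof (psum_nonneg (fun i => f (i + Z.of_nat 1 + j)%Z) (N - 1)
                (fun i _ => H _)).
  replace (f (Z.of_nat 0 + j)%Z) with (f j) by (f_equal; lia). lra.
Qed.

(** The lattice counterpart of the integral over a circle of length [N e]. *)
Definition lint (e : R) (N : nat) (f : Z -> R) : R := e * psum f N.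
Definition ld (e : R) (f : Z -> R) (i : Z) : R := (f (i + 1)%Z - f i) / e.

Section Lattice.

Context (e : R) (N : nat).

Lemma periodic_shift j f :
  periodic N f -> periodic N (fun i => f (i + j)%Z).
Proof. intros Hf i. rewrite <- (Hf (i + j)%Z). f_equal. lia. Qed.

Lemma periodic_map2 (F : R -> R -> R) f g :
  periodic N f -> periodic N g -> periodic N (fun i => F (f i) (g i)).
Proof. intros Hf Hg i. now rewrite Hf, Hg. Qed.

Lemma periodic_map (F : R -> R) f :
  periodic N f -> periodic N (fun i => F (f i)).
Proof. intros Hf i. now rewrite Hf. Qed.

Lemma periodic_ld f : periodic N f -> periodic N (ld e f).
Proof.
  intros Hf i. unfold ld. rewrite Hf.
  replace (i + Z.of_nat N + 1)%Z with (i + 1 + Z.of_nat N)%Z by lia.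
  now rewrite Hf.
Qed.

Context (He : 0 < e) (HN : (0 < N)%nat).

Lemma lint_ext f g : (forall i, f i = g i) -> lint e N f = lint e N g.
Proof. intros H. unfold lint. f_equal. apply psum_ext. intros; apply H. Qed.

Lemma lint_le f g : (forall i, f i <= g i) -> lint e N f <= lint e N g.
Proof.
  intros H. apply Rmult_le_compat_l; [lra|]. apply psum_le. intros; apply H.
Qed.

Lemma lint_nonneg f : (forall i, 0 <= f i) -> 0 <= lint e N f.
Proof.
  intros H. apply Rmult_le_pos; [lra|]. apply psum_nonneg. intros; apply H.
Qed.

Lemma lint_plus f g : lint e N (fun i => f i + g i) = lint e N f + lint e N g.
Proof. unfold lint. rewrite psum_plus. ring. Qed.

Lemma lint_minus f g : lint e N (fun i => f i - g i) = lint e N f - lint e N g.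
Proof. unfold lint. rewrite psum_minus. ring. Qed.

Lemma lint_scal c f : lint e N (fun i => c * f i) = c * lint e N f.
Proof. unfold lint. rewrite psum_scal. ring. Qed.

Lemma lint_shift f j :
  periodic N f -> lint e N (fun i => f (i + j)%Z) = lint e N f.
Proof. intros H. unfold lint. now rewrite psum_periodic_shift. Qed.

Lemma lint_term f j :
  periodic N f -> (forall i, 0 <= f i) -> e * f j <= lint e N f.
Proof.
  intros Hf H. apply Rmult_le_compat_l; [lra|]. now apply psum_periodic_term.
Qed.

Lemma lint_zero f j :
  periodic N f -> (forall i, 0 <= f i) -> lint e N f <= 0 -> f j = 0.
Proof.
  intros Hf H H0. pose proof (lint_term f j Hf H). specialize (H j). nra.
Qed.

Lemma summation_by_parts f g :
  periodic N f -> periodic N g ->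
  lint e N (fun i => ld e f i * g i)
  = - lint e N (fun i => f (i + 1)%Z * ld e g i).
Proof.
  intros Hf Hg.
  assert (H : lint e N (fun i => ld e f i * g i)
            + lint e N (fun i => f (i + 1)%Z * ld e g i)
            = / e * (lint e N (fun i => f (i + 1)%Z * g (i + 1)%Z)
                   - lint e N (fun i => f i * g i))).
  { rewrite <- lint_plus, <- lint_minus, <- lint_scal.
    apply lint_ext. intros i. unfold ld. field. lra. }
  rewrite (lint_shift (fun i => f i * g i) 1) in H; [lra|].
  now apply (periodic_map2 Rmult).
Qed.

(** Along the lattice [f ^ 2] changes by at most the integral of
    [f ^ 2 + (ld f) ^ 2]; averaging over the base point bounds it
    pointwise. *)
Lemma lattice_sobolev f i :
  1 <= INR N * e -> periodic N f ->
  f i ^ 2 <= 2 * lint e N (fun j => f j ^ 2) + lint e N (fun j => ld e f j ^ 2).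
Proof.
  intros HL Hf.
  set (F := lint e N (fun j => f j ^ 2)).
  set (D := lint e N (fun j => ld e f j ^ 2)).
  assert (HF : 0 <= F) by (apply lint_nonneg; intros; apply pow2_ge_0).
  set (q := fun j => ld e f j ^ 2 + (f (j + 1)%Z ^ 2 + f j ^ 2) / 2).
  assert (Hq0 : forall j, 0 <= q j).
  { intros j. unfold q. pose proof (pow2_ge_0 (ld e f j)).
    pose proof (pow2_ge_0 (f j)). pose proof (pow2_ge_0 (f (j+1)%Z)). lra. }
  assert (Hqp : periodic N q).
  { intros j. unfold q. rewrite periodic_ld, Hf by assumption.
    replace (j + Z.of_nat N + 1)%Z with (j + 1 + Z.of_nat N)%Z by lia.
    now rewrite Hf. }
  assert (Hq : lint e N q = D + F).
  { unfold q.
    rewrite (lint_ext _ (fun j => ld e f j ^ 2 +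
       (1/2) * (f (j + 1)%Z ^ 2 + f j ^ 2))) by (intros; field).
    rewrite lint_plus, lint_scal, lint_plus.
    rewrite (lint_shift (fun j => f j ^ 2) 1).
    - unfold F, D. field.
    - now apply (periodic_map (fun x => x ^ 2)). }
  assert (Hstep : forall j, Rabs (f (j + 1)%Z ^ 2 - f j ^ 2) <= e * q j).
  { intros j. assert (E : f (j+1)%Z = f j + e * ld e f j).
    { unfold ld. field. lra. }
    unfold q. rewrite E. set (x := f j). set (y := ld e f j).
    apply Rabs_le. 
    assert (0 <= e * (y + (2 * x + e * y)/2)^2) by (apply Rmult_le_pos; [lra|apply pow2_ge_0]).
    assert (0 <= e * (y - (2 * x + e * y)/2)^2) by (apply Rmult_le_pos; [lra|apply pow2_ge_0]).
    assert (0 <= e * (e * y / 2)^2) by (apply Rmult_le_pos; [lra|apply pow2_ge_0]).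
    split; nra. }
  (* from [i], every lattice point is reached in fewer than [N] steps *)
  assert (Hwalk : forall n, (n <= N)%nat ->
            f i ^ 2 - (D + F) <= f (i + Z.of_nat n)%Z ^ 2).
  { assert (Hw : forall n, f i ^ 2 - e * psum (fun j => q (j + i)%Z) n
                 <= f (i + Z.of_nat n)%Z ^ 2).
    { induction n as [|n IH]; cbn [psum].
      - rewrite Z.add_0_r. lra.
      - specialize (Hstep (i + Z.of_nat n)%Z). apply Rabs_le_between in Hstep.
        replace (i + Z.of_nat (S n))%Z with (i + Z.of_nat n + 1)%Z by lia.
        replace (Z.of_nat n + i)%Z with (i + Z.of_nat n)%Z by lia. lra. }
    intros n Hn. apply Rle_trans with (2 := Hw n).
    rewrite <- Hq. unfold lint. rewrite <- (psum_periodic_shift N q i Hqp).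
    pose proof (psum_mono (fun j => q (j + i)%Z) n N (fun j => Hq0 _) Hn). nra. }
  assert (Havg : INR N * e * (f i ^ 2 - (D + F)) <= F).
  { unfold F at 2. unfold lint.
    rewrite <- (psum_periodic_shift N (fun j => f j ^ 2) i).
    - rewrite Rmult_comm, <- Rmult_assoc, (Rmult_comm _ e), (Rmult_comm _ (INR N)).
      apply Rmult_le_compat_l; [lra|].
      rewrite <- psum_const. apply psum_le. intros j Hj.
      specialize (Hwalk (Z.to_nat j)).
      replace (i + Z.of_nat (Z.to_nat j))%Z with (j + i)%Z in Hwalk by lia.
      apply Hwalk. lia.
    - now apply (periodic_map (fun x => x ^ 2)). }
  destruct (Rle_lt_dec (f i ^ 2 - (D + F)) 0); [lra|]. nra.
Qed.

End Lattice.

(** * The constrained minimum on the lattice *)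

(** [D ^ 2 + sigma], centred at [i + 1] so that only forward differences
    occur. *)
Definition lop (e sigma : R) (v : Z -> R) (i : Z) : R :=
  ld e (ld e v) i + sigma * v (i + 1)%Z.

Definition lenergy (e sigma kappa k : R) (N : nat) (w v : Z -> R) : R :=
  lint e N (fun i => w i ^ 2 / 2
                     + k / 2 * (lop e sigma v i ^ 2 + kappa * v i ^ 2)
                     - k * (w i * v i)).

Definition admissible (e : R) (N : nat) (w v : Z -> R) : Prop :=
  periodic N w /\ (forall i, 0 <= w i) /\ lint e N w = 1 /\ periodic N v.

Lemma quadratic_nonneg_linear_zero p q :
  (forall t, 0 <= t * p + t ^ 2 * q) -> p = 0.
Proof.
  intros H.
  destruct (Req_dec p 0) as [|Hp]; [assumption|exfalso].
  pose proof (Rabs_pos q) as Hq. pose proof (Rle_abs q) as Hq'.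
  specialize (H (- p / (1 + Rabs q))).
  assert (E : - p / (1 + Rabs q) * p + (- p / (1 + Rabs q)) ^ 2 * q
            = - (p / (1 + Rabs q)) ^ 2 * (1 + Rabs q - q)) by (field; lra).
  rewrite E in H.
  assert (0 < (p / (1 + Rabs q)) ^ 2).
  { apply pow2_gt_0. unfold Rdiv. apply Rmult_integral_contrapositive.
    split; [assumption|]. apply Rinv_neq_0_compat. lra. }
  nra.
Qed.

Lemma onesided_quadratic_linear_nonneg p q :
  (forall t, 0 <= t <= 1 -> 0 <= t * p + t ^ 2 * q) -> 0 <= p.
Proof.
  intros H. apply Rnot_lt_le. intro Hp.
  pose proof (Rabs_pos q) as Hq. pose proof (Rle_abs q) as Hq'.
  set (t := - p / (1 + Rabs q - p)).
  assert (Ht : t * (1 + Rabs q - p) = - p) by (unfold t; field; lra).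
  assert (0 < t) by (unfold t; apply Rdiv_lt_0_compat; lra).
  assert (t <= 1) by nra.
  specialize (H t (conj (Rlt_le _ _ H0) H1)).
  assert (0 <= p + t * q) by nra.
  nra.
Qed.

Section Minimum.

Context (e sigma kappa k : R) (N : nat).
Context (He : 0 < e) (HN : (0 < N)%nat) (Hkappa : 0 < kappa) (Hk : 0 < k).

Lemma periodic_lop v : periodic N v -> periodic N (lop e sigma v).
Proof.
  intros Hv. unfold lop.
  apply (periodic_map2 N (fun x y => x + sigma * y)).
  - now apply periodic_ld, periodic_ld.
  - now apply periodic_shift.
Qed.

(** Young's inequality absorbs [k w v] into the [v ^ 2] term; what is left in
    [w] is bounded because [lint w = 1] forces [w <= / e]. The bound degenerates
    with [e], which is harmless for a single lattice. *)
Lemma lenergy_coercive w v :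
  admissible e N w v ->
  lenergy e sigma kappa k N w v
  >= k * kappa / 4 * lint e N (fun i => v i ^ 2) - k / kappa * / e.
Proof.
  intros (Hw & Hw0 & Hw1 & Hv). apply Rle_ge.
  apply Rle_trans with
    (lint e N (fun i => k * kappa / 4 * v i ^ 2 - k / kappa * (/ e * w i))).
  - rewrite lint_minus, !lint_scal, Hw1. lra.
  - unfold lenergy. apply lint_le; [assumption|]. intros i.
    assert (Hwi : w i <= / e).
    { apply Rmult_le_reg_l with e; [lra|]. rewrite Rinv_r by lra.
      rewrite <- Hw1. now apply lint_term. }
    specialize (Hw0 i).
    assert (H1 : 0 <= k * (lop e sigma v i) ^ 2)
      by (apply Rmult_le_pos; [lra | apply pow2_ge_0]).
    assert (H2 : w i ^ 2 <= / e * w i) by nra.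
    assert (H3 : k * (w i * v i) <= k * kappa / 4 * v i ^ 2 + k / kappa * w i ^ 2).
    { assert (0 <= k / kappa * (kappa / 2 * v i - w i) ^ 2).
      { apply Rmult_le_pos; [|apply pow2_ge_0].
        apply Rlt_le, Rdiv_lt_0_compat; lra. }
      replace (k / kappa * (kappa / 2 * v i - w i) ^ 2) with
        (k * kappa / 4 * v i ^ 2 + k / kappa * w i ^ 2 - k * (w i * v i)) in H
        by (field; lra). lra. }
    assert (0 < k / kappa) by (apply Rdiv_lt_0_compat; lra).
    pose proof (pow2_ge_0 (w i)).
    assert (k / kappa * w i ^ 2 <= k / kappa * (/ e * w i))
      by (apply Rmult_le_compat_l; lra).
    lra.
Qed.

(** The admissible pairs with bounded energy are bounded at each lattice point
    and the energy involves finitely many of them, so a minimising sequence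
    converges pointwise along an ultrafilter to a minimiser. *)
Lemma lenergy_minimum_exists w0 v0 :
  admissible e N w0 v0 ->
  exists w v, admissible e N w v /\
    forall w' v', admissible e N w' v' ->
      lenergy e sigma kappa k N w v <= lenergy e sigma kappa k N w' v'.
Proof.
  intros H0. set (Psi := lenergy e sigma kappa k N).
  destruct (completeness
    (fun r => exists w v, admissible e N w v /\ r = - Psi w v)) as [m [Hub Hlub]].
  { exists (k / kappa * / e). intros r (w & v & Hwv & ->).
    pose proof (lenergy_coercive w v Hwv). fold Psi in H.
    assert (0 <= lint e N (fun i => v i ^ 2))
      by (apply lint_nonneg; [assumption | intros; apply pow2_ge_0]).
    assert (0 < k * kappa) by nra. nra. }
  { now exists (- Psi w0 v0), w0, v0. }
  assert (Hseq : forall n : nat, exists p : (Z -> R) * (Z -> R),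
     admissible e N (fst p) (snd p) /\ Psi (fst p) (snd p) <= - m + / (INR n + 1)).
  { intros n. apply NNPP. intros Hno.
    assert (Hn : 0 < / (INR n + 1)) by (apply Rinv_0_lt_compat; pose proof (pos_INR n); lra).
    assert (m <= m - / (INR n + 1)); [|lra].
    apply Hlub. intros r (w & v & Hwv & ->). apply Rnot_lt_le. intro Hlt.
    apply Hno. exists (w, v). split; [assumption | simpl; lra]. }
  apply functional_choice in Hseq. destruct Hseq as [p Hp].
  destruct free_ultrafilter as (U & PU & ultra & Hev).
  assert (Hw : forall i, exists l, ulim U (fun n => fst (p n) i) l).
  { intros i. apply (ulim_exists U _ (/ e) ultra). apply filter_forall. intros n.
    destruct (Hp n) as [(Hw & Hw0 & Hw1 & Hv) _].
    rewrite Rabs_pos_eq by apply Hw0.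
    apply Rmult_le_reg_l with e; [lra|]. rewrite Rinv_r by lra.
    rewrite <- Hw1. now apply lint_term. }
  assert (Hv : forall i, exists l, ulim U (fun n => snd (p n) i) l).
  { intros i. set (B := (- m + 1 + k / kappa * / e) / (k * kappa / 4 * e)).
    apply (ulim_exists U _ (1 + B) ultra). apply filter_forall. intros n.
    destruct (Hp n) as [Hadm Hle]. pose proof (lenergy_coercive _ _ Hadm) as Hc.
    fold Psi in Hc. destruct Hadm as (_ & _ & _ & Hv).
    assert (Hn : / (INR n + 1) <= 1).
    { rewrite <- Rinv_1. apply Rinv_le_contravar; pose proof (pos_INR n); lra. }
    pose proof (lint_term e N He HN (fun i => snd (p n) i ^ 2) i
      (periodic_map N (fun x => x ^ 2) _ Hv) (fun i => pow2_ge_0 _)) as Ht.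
    cbv beta in Ht. set (x := snd (p n) i) in *.
    assert (Hkk : 0 < k * kappa) by nra.
    assert (Hx : x ^ 2 <= B).
    { unfold B. apply Rmult_le_reg_l with (k * kappa / 4 * e); [nra|].
      replace (k * kappa / 4 * e *
        ((- m + 1 + k / kappa * / e) / (k * kappa / 4 * e)))
        with (- m + 1 + k / kappa * / e) by (field; lra).
      nra. }
    apply Rabs_le. nra. }
  apply functional_choice in Hw. destruct Hw as [w Hw].
  apply functional_choice in Hv. destruct Hv as [v Hv].
  exists w, v.
  assert (Hadm : admissible e N w v).
  { split; [|split; [|split]].
    - intros i. apply (ulim_unique U (fun n => fst (p n) (i + Z.of_nat N)%Z)); [apply Hw|].
      apply (ulim_ext U (fun n => fst (p n) i)); [|apply Hw].
      apply filter_forall. intros n. symmetry. apply (proj1 (Hp n)).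
    - intros i. apply (ulim_le U (fun _ => 0) (fun n => fst (p n) i));
        [ulim | apply Hw |].
      apply filter_forall. intros n. apply (proj1 (Hp n)).
    - apply (ulim_unique U (fun n => lint e N (fst (p n)))).
      + unfold lint. ulim. now apply (psum_ulim U).
      + apply (ulim_ext U (fun _ => 1)); [|ulim].
        apply filter_forall. intros n. symmetry. apply (proj1 (Hp n)).
    - intros i. apply (ulim_unique U (fun n => snd (p n) (i + Z.of_nat N)%Z)); [apply Hv|].
      apply (ulim_ext U (fun n => snd (p n) i)); [|apply Hv].
      apply filter_forall. intros n. symmetry. apply (proj1 (Hp n)). }
  split; [exact Hadm|].
  intros w' v' Hadm'. apply Rle_trans with (- m).
  - apply (ulim_le U (fun n => Psi (fst (p n)) (snd (p n)))
                   (fun n => - m + / (INR n + 1))).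
    + unfold Psi, lenergy, lint. ulim.
      apply (psum_ulim U). intros i. unfold lop, ld. ulim; first [apply Hw | apply Hv].
    + assert (Hinv : ulim U (fun n => / (INR n + 1)) 0).
      { apply ulim_lim_seq; [assumption|].
        apply (is_lim_seq_ext (fun n => / INR (S n))).
        - intros n. now rewrite S_INR.
        - apply (is_lim_seq_incr_1 (fun n => / INR n)).
          apply (is_lim_seq_inv INR p_infty); [apply is_lim_seq_INR | discriminate]. }
      pose proof (ulim_plus U _ _ _ _ (ulim_const U (- m)) Hinv) as Hsum.
      now rewrite Rplus_0_r in Hsum.
    + apply filter_forall. intros n. apply (proj2 (Hp n)).
  - assert (- Psi w' v' <= m); [|unfold Psi in *; lra].
    apply Hub. now exists w', v'.
Qed.

(** [L v - w]: the first two terms are the adjoint of [lop] applied to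
    [lop v]. *)
Definition lresidual (w v : Z -> R) (i : Z) : R :=
  ld e (ld e (lop e sigma v)) (i - 2)%Z + sigma * lop e sigma v (i - 1)%Z
  + kappa * v i - w i.

Lemma lop_adjoint g v :
  periodic N g -> periodic N v ->
  lint e N (fun i => g i * lop e sigma v i)
  = lint e N (fun i => (ld e (ld e g) (i - 2)%Z + sigma * g (i - 1)%Z) * v i).
Proof.
  intros Hg Hv.
  assert (Hg1 := periodic_ld e N _ Hg). assert (Hg2 := periodic_ld e N _ Hg1).
  assert (Hv1 := periodic_ld e N _ Hv).
  rewrite (lint_ext e N _ (fun i => ld e (ld e v) i * g i
             + sigma * (g i * v (i + 1)%Z))) by (intros; unfold lop; ring).
  rewrite lint_plus, lint_scal.
  rewrite (summation_by_parts e N He (ld e v) g Hv1 Hg).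
  rewrite <- (lint_shift e N (fun i => ld e v (i + 1)%Z * ld e g i) (-1)).
  2: { apply (periodic_map2 N Rmult); [now apply periodic_shift | assumption]. }
  rewrite (lint_ext e N _ (fun i => ld e v i * ld e g (i - 1)%Z))
    by (intros i; replace (i + -1 + 1)%Z with i by lia;
        now replace (i + -1)%Z with (i - 1)%Z by lia).
  rewrite (summation_by_parts e N He v (fun i => ld e g (i - 1)%Z) Hv)
    by now apply (periodic_shift N (-1)).
  rewrite <- (lint_shift e N (fun i => v (i + 1)%Z
             * ld e (fun i => ld e g (i - 1)%Z) i) (-1)).
  2: { apply (periodic_map2 N Rmult); [now apply periodic_shift |].
       apply periodic_ld. now apply (periodic_shift N (-1)). }
  rewrite <- (lint_shift e N (fun i => g i * v (i + 1)%Z) (-1)).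
  2: { apply (periodic_map2 N Rmult); [assumption | now apply periodic_shift]. }
  rewrite Ropp_involutive, <- lint_scal, <- lint_plus.
  apply lint_ext. intros i. unfold ld.
  replace (i + -1 + 1)%Z with i by lia.
  replace (i + -1 - 1)%Z with (i - 2)%Z by lia.
  replace (i - 2 + 1)%Z with (i - 1)%Z by lia.
  replace (i + -1)%Z with (i - 1)%Z by lia.
  replace (i - 1 + 1)%Z with i by lia. ring.
Qed.

(** The first variation in [v] is the pairing with the residual, and the
    residual is itself an allowed direction. *)
Lemma minimum_residual_zero w v :
  admissible e N w v ->
  (forall w' v', admissible e N w' v' ->
     lenergy e sigma kappa k N w v <= lenergy e sigma kappa k N w' v') ->
  forall i, lresidual w v i = 0.
Proof.
  intros (Hw & Hw0 & Hw1 & Hv) Hmin.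
  set (r := lresidual w v).
  assert (Hlop := periodic_lop v Hv).
  assert (Hr : periodic N r).
  { intros i. unfold r, lresidual.
    replace (i + Z.of_nat N - 2)%Z with (i - 2 + Z.of_nat N)%Z by lia.
    replace (i + Z.of_nat N - 1)%Z with (i - 1 + Z.of_nat N)%Z by lia.
    rewrite Hv, Hw, Hlop, (periodic_ld e N _ (periodic_ld e N _ Hlop)).
    reflexivity. }
  assert (Hvar : k * lint e N (fun i => r i ^ 2) = 0).
  { apply quadratic_nonneg_linear_zero with
      (q := k / 2 * lint e N (fun i => lop e sigma r i ^ 2 + kappa * r i ^ 2)).
    intros t.
    assert (Hadm : admissible e N w (fun i => v i + t * r i)).
    { repeat split; auto. now apply (periodic_map2 N (fun x y => x + t * y)). }
    apply Hmin in Hadm. unfold lenergy in Hadm.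
    rewrite (lint_ext e N (fun i => w i ^ 2 / 2 + k / 2 *
        (lop e sigma (fun i => v i + t * r i) i ^ 2 + kappa * (v i + t * r i) ^ 2)
        - k * (w i * (v i + t * r i))) (fun i =>
        (w i ^ 2 / 2 + k / 2 * (lop e sigma v i ^ 2 + kappa * v i ^ 2)
        - k * (w i * v i))
        + (t * k * (lop e sigma v i * lop e sigma r i
                    + (kappa * v i - w i) * r i)
        + t ^ 2 * (k / 2) * (lop e sigma r i ^ 2 + kappa * r i ^ 2)))) in Hadm.
    2: { intros i.
         assert (E : lop e sigma (fun i => v i + t * r i) i
                     = lop e sigma v i + t * lop e sigma r i)
           by (unfold lop, ld; field; lra).
         rewrite E. field. }
    rewrite lint_plus, lint_plus, !lint_scal, lint_plus in Hadm.
    rewrite (lop_adjoint (lop e sigma v) r Hlop Hr), <- lint_plus in Hadm.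
    rewrite (lint_ext e N (fun i =>
        (ld e (ld e (lop e sigma v)) (i - 2)%Z
         + sigma * lop e sigma v (i - 1)%Z) * r i + (kappa * v i - w i) * r i)
        (fun i => r i ^ 2)) in Hadm.
    2: { intros i. unfold r at 3, lresidual. unfold r, lresidual. ring. }
    lra. }
  intros i.
  assert (Hz : r i ^ 2 = 0).
  { apply (lint_zero e N He HN (fun i => r i ^ 2)).
    - now apply (periodic_map N (fun x => x ^ 2)).
    - intros; apply pow2_ge_0.
    - nra. }
  nra.
Qed.

(** Moving mass inside the simplex [w >= 0], [lint w = 1] shows that
    [w - k v] attains its minimum wherever [w > 0]; integrating against [w]
    identifies the minimum. *)
Lemma minimum_complementarity w v :
  admissible e N w v ->
  (forall w' v', admissible e N w' v' ->
     lenergy e sigma kappa k N w v <= lenergy e sigma kappa k N w' v') ->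
  forall i, w i = Rmax (k * v i - lint e N (fun j => (k * v j - w j) * w j)) 0.
Proof.
  intros (Hw & Hw0 & Hw1 & Hv) Hmin.
  set (h := lint e N (fun j => (k * v j - w j) * w j)).
  set (g := fun i => w i - k * v i + h).
  assert (Hg : periodic N g).
  { now apply (periodic_map2 N (fun x y => x - k * y + h)). }
  assert (Hgw : lint e N (fun i => g i * w i) = 0).
  { rewrite (lint_ext e N _ (fun i => h * w i - (k * v i - w i) * w i))
      by (intros; unfold g; ring).
    rewrite lint_minus, lint_scal, Hw1. fold h. ring. }
  assert (Hvar : forall w', periodic N w' -> (forall i, 0 <= w' i) ->
            lint e N w' = 1 -> 0 <= lint e N (fun i => g i * w' i)).
  { intros w' Hw' Hw0' Hw1'.
    apply onesided_quadratic_linear_nonneg with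
      (q := lint e N (fun i => 1 / 2 * (w' i - w i) ^ 2)).
    intros t Ht.
    assert (Hadm : admissible e N (fun i => w i + t * (w' i - w i)) v).
    { repeat split; auto.
      - now apply (periodic_map2 N (fun x y => x + t * (y - x))).
      - intros i. specialize (Hw0 i). specialize (Hw0' i). nra.
      - rewrite lint_plus, lint_scal, lint_minus, Hw1, Hw1'. ring. }
    apply Hmin in Hadm. unfold lenergy in Hadm.
    rewrite (lint_ext e N (fun i => (w i + t * (w' i - w i)) ^ 2 / 2 + k / 2 *
        (lop e sigma v i ^ 2 + kappa * v i ^ 2)
        - k * ((w i + t * (w' i - w i)) * v i)) (fun i =>
        (w i ^ 2 / 2 + k / 2 * (lop e sigma v i ^ 2 + kappa * v i ^ 2)
        - k * (w i * v i))
        + (t * (g i * w' i - g i * w i - h * (w' i - w i))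
        + t ^ 2 * (1 / 2 * (w' i - w i) ^ 2)))) in Hadm
      by (intros i; unfold g; field).
    rewrite lint_plus in Hadm.
    assert (E : lint e N (fun i => g i * w' i - g i * w i - h * (w' i - w i))
                = lint e N (fun i => g i * w' i)).
    { rewrite !lint_minus, lint_scal, lint_minus, Hgw, Hw1, Hw1'. ring. }
    rewrite <- E, <- (lint_scal _ _ t), <- (lint_scal _ _ (t ^ 2)), <- lint_plus.
    lra. }
  assert (Hg0 : forall i, 0 <= g i).
  { (* test against the normalised negative part of [g] *)
    set (q := fun i => Rmax (- g i) 0).
    assert (Hq : periodic N q) by now apply (periodic_map N (fun x => Rmax (- x) 0)).
    assert (Hq0 : forall i, 0 <= q i) by (intros; apply Rmax_r).
    assert (Hqg : forall i, g i * q i = - q i ^ 2).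
    { intros i. unfold q, Rmax. destruct Rle_dec; ring. }
    assert (Hqz : forall i, q i ^ 2 = 0).
    { intros i. apply (lint_zero e N He HN (fun i => q i ^ 2)).
      - now apply (periodic_map N (fun x => x ^ 2)).
      - intros; apply pow2_ge_0.
      - destruct (Rle_lt_dec (lint e N q) 0) as [Hle|Hlt].
        + rewrite (lint_ext e N _ (fun _ => 0 * 0)).
          * rewrite (lint_scal e N 0 (fun _ => 0)). lra.
          * intros j. rewrite (lint_zero e N He HN q j Hq Hq0 Hle). ring.
        + assert (Hi : 0 < / lint e N q) by now apply Rinv_0_lt_compat.
          assert (Hv' : 0 <= lint e N (fun i => g i * (/ lint e N q * q i))).
          { apply (Hvar (fun i => / lint e N q * q i)).
            - now apply (periodic_map N (fun x => / lint e N q * x)).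
            - intros j. apply Rmult_le_pos; [lra | apply Hq0].
            - rewrite lint_scal. field. lra. }
          rewrite (lint_ext e N _ (fun i => - / lint e N q * q i ^ 2)) in Hv'.
          2: { intros j. replace (g j * (/ lint e N q * q j))
                 with (/ lint e N q * (g j * q j)) by ring.
               rewrite Hqg. ring. }
          rewrite lint_scal in Hv'. nra. }
    intros i. specialize (Hqz i).
    assert (H : q i = 0)
      by (apply NNPP; intro Hne; exact (pow_nonzero _ 2 Hne Hqz)).
    unfold q, Rmax in H. destruct Rle_dec in H; lra. }
  intros i.
  assert (Hz : g i * w i = 0).
  { apply (lint_zero e N He HN (fun i => g i * w i)).
    - now apply (periodic_map2 N Rmult).
    - intros; now apply Rmult_le_pos.
    - lra. }
  specialize (Hg0 i). specialize (Hw0 i).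
  assert (Hgi : g i = w i - (k * v i - h)) by (unfold g; ring).
  rewrite Hgi in *.
  apply Rmult_integral in Hz. destruct Hz as [Hz|Hz].
  - rewrite Rmax_left; lra.
  - rewrite Rmax_right; lra.
Qed.

Lemma minimum_quadratic_form w v :
  periodic N w -> periodic N v -> (forall i, lresidual w v i = 0) ->
  lint e N (fun i => lop e sigma v i ^ 2 + kappa * v i ^ 2)
  = lint e N (fun i => w i * v i).
Proof.
  intros Hw Hv Hr.
  assert (Hlop := periodic_lop v Hv).
  rewrite (lint_ext e N _ (fun i => lop e sigma v i * lop e sigma v i
             + kappa * v i * v i)) by (intros; ring).
  rewrite lint_plus, (lop_adjoint (lop e sigma v) v Hlop Hv), <- lint_plus.
  apply lint_ext. intros i. specialize (Hr i). unfold lresidual in Hr.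
  replace (w i) with (ld e (ld e (lop e sigma v)) (i - 2)%Z
    + sigma * lop e sigma v (i - 1)%Z + kappa * v i) by lra. ring.
Qed.

End Minimum.

(** * Bounds that do not depend on the lattice *)

Definition lattice_solution (e sigma kappa k h : R) (N : nat) (w v : Z -> R) :=
  admissible e N w v /\ (forall i, lresidual e sigma kappa w v i = 0) /\
  (forall i, w i = Rmax (k * v i - h) 0).

(** Expanding [lop] turns [L v = w] into an explicit recursion, which bounds
    the fourth difference by lower order quantities. *)
Lemma lattice_fourth_difference e sigma kappa w v :
  0 < e -> (forall i, lresidual e sigma kappa w v i = 0) ->
  forall i, ld e (ld e (ld e (ld e v))) i
    = w (i + 2)%Z - 2 * sigma * ld e (ld e v) (i + 1)%Z
      - (sigma ^ 2 + kappa) * v (i + 2)%Z.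
Proof.
  intros He Hr i. specialize (Hr (i + 2)%Z). unfold lresidual in Hr.
  replace (i + 2 - 2)%Z with i in Hr by lia.
  replace (i + 2 - 1)%Z with (i + 1)%Z in Hr by lia.
  assert (E : ld e (ld e (lop e sigma v)) i
    = ld e (ld e (ld e (ld e v))) i + sigma * ld e (ld e v) (i + 1)%Z).
  { unfold lop, ld. field. lra. }
  assert (E' : lop e sigma v (i + 1)%Z
    = ld e (ld e v) (i + 1)%Z + sigma * v (i + 2)%Z).
  { unfold lop. now replace (i + 1 + 1)%Z with (i + 2)%Z by lia. }
  rewrite E, E' in Hr. lra.
Qed.

Lemma interpolation e N f :
  0 < e -> periodic N f ->
  lint e N (fun i => ld e f i ^ 2)
  <= (lint e N (fun i => f i ^ 2) + lint e N (fun i => ld e (ld e f) i ^ 2)) / 2.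
Proof.
  intros He Hf. pose proof (periodic_ld e N _ Hf) as Hf1.
  rewrite (lint_ext e N (fun i => ld e f i ^ 2) (fun i => ld e f i * ld e f i))
    by (intros; ring).
  rewrite (summation_by_parts e N He f (ld e f) Hf Hf1).
  rewrite <- (lint_shift e N (fun i => f i ^ 2) 1)
    by now apply (periodic_map N (fun x => x ^ 2)).
  assert (H : lint e N (fun i => -1 * (f (i + 1)%Z * ld e (ld e f) i))
     <= lint e N (fun i => 1 / 2 * (f (i + 1)%Z ^ 2 + ld e (ld e f) i ^ 2))).
  { apply lint_le; [assumption|]. intros i.
    pose proof (pow2_ge_0 (f (i + 1)%Z + ld e (ld e f) i)). nra. }
  rewrite !lint_scal, lint_plus in H. lra.
Qed.

Lemma Rabs_le_sqr x B : x ^ 2 <= B -> Rabs x <= 1 + B.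
Proof. intros H. apply Rabs_le. nra. Qed.

Section Estimates.

Context (sigma kappa k : R).
Context (Hsigma : 0 < sigma) (Hkappa : 0 < kappa) (Hk : 0 < k).

(** The total mass [lint w = 1] turns a sup bound on [v] into an energy bound,
    and the Sobolev inequality turns the energy bound into a sup bound of
    square root size; together they bound the energy. *)
Lemma lattice_energy_bound :
  exists C, 0 < C /\ forall e h N w v,
    0 < e -> (0 < N)%nat -> 1 <= INR N * e -> 0 <= h ->
    lattice_solution e sigma kappa k h N w v ->
    lint e N (fun i => v i ^ 2) <= C /\
    lint e N (fun i => ld e v i ^ 2) <= C /\
    lint e N (fun i => ld e (ld e v) i ^ 2) <= C.
Proof.
  set (K := (5 / 2 + sigma ^ 2) / kappa + 1).
  assert (Hs2 : 0 < sigma ^ 2) by now apply pow_lt.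
  assert (HK : 0 < K) by (unfold K; apply Rplus_lt_0_compat; [apply Rdiv_lt_0_compat|]; lra).
  exists (K / kappa + 2 * K + 2 * sigma ^ 2 * (K / kappa)).
  assert (HKk : 0 < K / kappa) by now apply Rdiv_lt_0_compat.
  split; [nra|].
  intros e h N w v He HN HL Hh [(Hw & Hw0 & Hw1 & Hv) [Hr Hc]].
  pose proof (minimum_quadratic_form e sigma kappa N He HN w v Hw Hv Hr) as HQ.
  rewrite lint_plus, lint_scal in HQ.
  pose proof (lint_nonneg e N He (fun i => lop e sigma v i ^ 2) (fun i => pow2_ge_0 _)) as HT.
  pose proof (lint_nonneg e N He (fun i => v i ^ 2) (fun i => pow2_ge_0 _)) as HX.
  pose proof (lint_nonneg e N He (fun i => ld e v i ^ 2) (fun i => pow2_ge_0 _)) as HY.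
  pose proof (interpolation e N v He Hv) as HXZ.
  assert (HZ : lint e N (fun i => ld e (ld e v) i ^ 2)
     <= 2 * lint e N (fun i => lop e sigma v i ^ 2)
        + 2 * sigma ^ 2 * lint e N (fun i => v i ^ 2)).
  { rewrite <- (lint_shift e N (fun i => v i ^ 2) 1)
      by now apply (periodic_map N (fun x => x ^ 2)).
    rewrite <- !lint_scal, <- lint_plus.
    apply lint_le; [assumption|]. intros i. unfold lop.
    pose proof (pow2_ge_0 (ld e (ld e v) i + 2 * (sigma * v (i + 1)%Z))). nra. }
  set (X := lint e N (fun i => v i ^ 2)) in *.
  set (Y := lint e N (fun i => ld e v i ^ 2)) in *.
  set (Z := lint e N (fun i => ld e (ld e v) i ^ 2)) in *.
  set (T := lint e N (fun i => lop e sigma v i ^ 2)) in *.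
  set (q := sqrt (2 * X + Y)).
  assert (Hq : 0 <= q) by apply sqrt_pos.
  assert (Hq2 : q ^ 2 = 2 * X + Y) by (unfold q; rewrite pow2_sqrt; lra).
  assert (HQq : T + kappa * X <= q).
  { rewrite HQ. rewrite <- (Rmult_1_r q), <- Hw1, <- lint_scal.
    apply lint_le; [assumption|]. intros i.
    pose proof (lattice_sobolev e N He HN v i HL Hv) as Hs. fold X Y in Hs.
    rewrite <- Hq2 in Hs. specialize (Hw0 i).
    assert (v i <= q) by (apply Rnot_lt_le; intro; nra). nra. }
  assert (HXQ : X <= (T + kappa * X) / kappa).
  { apply Rmult_le_reg_l with kappa; [lra|].
    replace (kappa * ((T + kappa * X) / kappa)) with (T + kappa * X) by (field; lra).
    lra. }
  assert (HqK : q ^ 2 <= K * q).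
  { rewrite Hq2. apply Rle_trans with (K * (T + kappa * X)); [|nra].
    replace (K * (T + kappa * X))
      with ((5 / 2 + sigma ^ 2) * ((T + kappa * X) / kappa) + (T + kappa * X))
      by (unfold K; field; lra).
    nra. }
  assert (HqK' : q <= K) by (apply Rnot_lt_le; intro; nra).
  assert (HXK : X <= K / kappa).
  { apply Rmult_le_reg_l with kappa; [lra|].
    replace (kappa * (K / kappa)) with K by (field; lra). lra. }
  assert (sigma ^ 2 * X <= sigma ^ 2 * (K / kappa)) by nra.
  repeat split; nra.
Qed.

(** The equation gives the fourth difference in the mean square, hence by
    interpolation the third, and then the Sobolev inequality gives sup
    bounds. *)
Lemma lattice_uniform_bounds :
  exists C, 0 < C /\ forall e h N w v,
    0 < e -> (0 < N)%nat -> 1 <= INR N * e -> 0 <= h ->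
    lattice_solution e sigma kappa k h N w v ->
    lint e N (fun i => v i ^ 2) <= C /\
    forall i, Rabs (v i) <= C /\ Rabs (ld e v i) <= C /\
      Rabs (ld e (ld e v) i) <= C /\ Rabs (ld e (ld e (ld e v)) i) <= C /\
      Rabs (ld e (ld e (ld e (ld e v))) i) <= C.
Proof.
  destruct lattice_energy_bound as [C0 [HC0 Hen]].
  set (a := sigma ^ 2 + kappa).
  assert (Ha : 0 < a) by (unfold a; pose proof (pow_lt sigma 2 Hsigma); lra).
  set (C4 := 3 * (k ^ 2 + 4 * sigma ^ 2 + a ^ 2) * C0).
  assert (HC4 : 0 <= C4).
  { unfold C4. pose proof (pow2_ge_0 k). pose proof (pow2_ge_0 sigma).
    pose proof (pow2_ge_0 a). apply Rmult_le_pos; lra. }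
  set (C1 := 1 + 3 * C0 + 2 * C4).
  set (C := C1 * (1 + k + 2 * sigma + a)).
  assert (HC1 : 0 < C1) by (unfold C1; lra).
  assert (HC : C1 <= C) by (unfold C; nra).
  exists C. split; [lra|].
  intros e h N w v He HN HL Hh Hsol.
  destruct (Hen e h N w v He HN HL Hh Hsol) as (HX & HY & HZ).
  destruct Hsol as [(Hw & Hw0 & Hw1 & Hv) [Hr Hc]].
  pose proof (lattice_fourth_difference e sigma kappa w v He Hr) as H4.
  pose proof (periodic_ld e N v Hv) as Hv1.
  pose proof (periodic_ld e N _ Hv1) as Hv2.
  pose proof (periodic_ld e N _ Hv2) as Hv3.
  assert (Hwv : forall i, 0 <= w i <= k * Rabs (v i)).
  { intros i. split; [apply Hw0|]. rewrite Hc.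
    pose proof (Rle_abs (v i)). pose proof (Rabs_pos (v i)).
    apply Rmax_lub; nra. }
  assert (HW4 : lint e N (fun i => ld e (ld e (ld e (ld e v))) i ^ 2) <= C4).
  { apply Rle_trans with (lint e N (fun i => 3 * (k ^ 2 * v (i + 2)%Z ^ 2
      + (4 * sigma ^ 2 * ld e (ld e v) (i + 1)%Z ^ 2 + a ^ 2 * v (i + 2)%Z ^ 2)))).
    - apply lint_le; [assumption|]. intros i. rewrite H4. fold a.
      destruct (Hwv (i + 2)%Z) as [H1 H2].
      assert (Hw2 : w (i + 2)%Z ^ 2 <= k ^ 2 * v (i + 2)%Z ^ 2).
      { rewrite <- (pow2_abs (v (i + 2)%Z)). nra. }
      set (x := w (i + 2)%Z) in *. set (y := 2 * sigma * ld e (ld e v) (i + 1)%Z).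
      set (z := a * v (i + 2)%Z).
      replace (4 * sigma ^ 2 * ld e (ld e v) (i + 1)%Z ^ 2) with (y ^ 2)
        by (unfold y; ring).
      replace (a ^ 2 * v (i + 2)%Z ^ 2) with (z ^ 2) by (unfold z; ring).
      pose proof (pow2_ge_0 (x + y)). pose proof (pow2_ge_0 (x + z)).
      pose proof (pow2_ge_0 (y - z)). nra.
    - rewrite lint_scal, lint_plus, lint_plus, !lint_scal.
      rewrite (lint_shift e N (fun i => v i ^ 2) 2)
        by now apply (periodic_map N (fun x => x ^ 2)).
      rewrite (lint_shift e N (fun i => ld e (ld e v) i ^ 2) 1)
        by now apply (periodic_map N (fun x => x ^ 2)).
      unfold C4. pose proof (pow2_ge_0 k). pose proof (pow2_ge_0 sigma).
      pose proof (pow2_ge_0 a). nra. }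
  pose proof (interpolation e N _ He Hv2) as H3.
  assert (Hb : forall f, periodic N f -> lint e N (fun i => f i ^ 2) <= C0 + C4 ->
     lint e N (fun i => ld e f i ^ 2) <= C0 + C4 ->
     2 * lint e N (fun i => f i ^ 2) + lint e N (fun i => ld e f i ^ 2)
       <= 3 * C0 + 2 * C4 -> forall i, Rabs (f i) <= C1).
  { intros f Hf _ _ H i. apply Rle_trans with (1 + (3 * C0 + 2 * C4)).
    - apply Rabs_le_sqr. apply Rle_trans with (2 := H). now apply lattice_sobolev.
    - unfold C1. lra. }
  assert (B0 := Hb v Hv). assert (B1 := Hb _ Hv1).
  assert (B2 := Hb _ Hv2). assert (B3 := Hb _ Hv3). clear Hb.
  split; [unfold C1 in *; lra|]. intros i.
  assert (B0' : forall i, Rabs (v i) <= C1) by (apply B0; lra).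
  assert (B2' : forall i, Rabs (ld e (ld e v) i) <= C1) by (apply B2; lra).
  repeat split.
  - specialize (B0' i). lra.
  - apply Rle_trans with (2 := HC). apply B1; lra.
  - specialize (B2' i). lra.
  - apply Rle_trans with (2 := HC). apply B3; lra.
  - rewrite H4. fold a.
    pose proof (B0' (i + 2)%Z) as Hx. pose proof (B2' (i + 1)%Z) as Hy.
    destruct (Hwv (i + 2)%Z) as [H1 H2].
    apply Rabs_le_between in Hy.
    assert (w (i + 2)%Z <= k * C1) by nra.
    assert (- C1 * sigma <= sigma * ld e (ld e v) (i + 1)%Z <= C1 * sigma) by nra.
    apply Rabs_le_between in Hx.
    assert (- C1 * a <= a * v (i + 2)%Z <= C1 * a) by nra.
    unfold C. apply Rabs_le. nra.
Qed.

End Estimates.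

(** * A modulated wave of negative energy *)

(** A bump with Lipschitz derivative, the regularity that bounds second
    differences. *)
Definition envelope (x : R) : R := Rmax (1 - x ^ 2) 0 ^ 2.

Lemma envelope_bounds x : 0 <= envelope x <= 1.
Proof. unfold envelope, Rmax. destruct Rle_dec; nra. Qed.

Lemma envelope_outside x : 1 <= Rabs x -> envelope x = 0.
Proof.
  intros H. unfold envelope. rewrite <- (pow2_abs x), Rmax_right by nra. ring.
Qed.

Lemma envelope_center x : Rabs x <= 1 / 2 -> 1 / 2 <= envelope x.
Proof.
  intros H. unfold envelope. rewrite <- (pow2_abs x).
  pose proof (Rabs_pos x). rewrite Rmax_left; nra.
Qed.

(** The square of the positive part has a Taylor expansion with quadratic
    remainder even across the kink, so no case distinction on the position of
    [y] is needed when [x] lies inside the support. *)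
Lemma envelope_taylor x y :
  Rabs (y - x) <= 1 ->
  Rabs (envelope y - envelope x + 4 * Rmax (1 - x ^ 2) 0 * x * (y - x))
  <= 11 * (y - x) ^ 2.
Proof.
  intros H.
  assert (Hpos : forall u v,
    Rabs (Rmax u 0 ^ 2 - Rmax v 0 ^ 2 - 2 * Rmax v 0 * (u - v)) <= (u - v) ^ 2).
  { intros u v. pose proof (pow2_ge_0 (u - v)). apply Rabs_le. unfold Rmax.
    destruct (Rle_dec u 0); destruct (Rle_dec v 0); nra. }
  specialize (Hpos (1 - y ^ 2) (1 - x ^ 2)).
  destruct (Rle_lt_dec 1 (Rabs x)) as [Hx|Hx];
    [destruct (Rle_lt_dec 1 (Rabs y)) as [Hy|Hy]|].
  - rewrite !envelope_outside by assumption.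
    rewrite <- (pow2_abs x), Rmax_right by nra.
    replace (0 - 0 + 4 * 0 * x * (y - x)) with 0 by ring.
    rewrite Rabs_R0. pose proof (pow2_ge_0 (y - x)). lra.
  - assert (Hs : (x + y) ^ 2 <= 9).
    { apply Rabs_def2 in Hy. apply Rabs_le_between in H. nra. }
    pose proof (pow2_ge_0 (y - x)).
    assert (Hp : Rmax (1 - x ^ 2) 0 = 0).
    { apply Rmax_right. rewrite <- (pow2_abs x). nra. }
    unfold envelope. rewrite Hp in *.
    replace (Rmax (1 - y ^ 2) 0 ^ 2 - 0 ^ 2 + 4 * 0 * x * (y - x))
      with (Rmax (1 - y ^ 2) 0 ^ 2 - 0 ^ 2 - 2 * 0 * (1 - y ^ 2 - (1 - x ^ 2)))
      by ring.
    apply Rle_trans with (1 := Hpos). nra.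
  - assert (Hs : (x + y) ^ 2 <= 9).
    { apply Rabs_def2 in Hx. apply Rabs_le_between in H. nra. }
    pose proof (pow2_ge_0 (y - x)).
    assert (Hp : Rmax (1 - x ^ 2) 0 = 1 - x ^ 2).
    { apply Rmax_left. rewrite <- (pow2_abs x). pose proof (Rabs_pos x). nra. }
    unfold envelope. rewrite Hp in *.
    replace (Rmax (1 - y ^ 2) 0 ^ 2 - (1 - x ^ 2) ^ 2
             + 4 * (1 - x ^ 2) * x * (y - x))
      with ((Rmax (1 - y ^ 2) 0 ^ 2 - (1 - x ^ 2) ^ 2
             - 2 * (1 - x ^ 2) * (1 - y ^ 2 - (1 - x ^ 2)))
            - 2 * (1 - x ^ 2) * (y - x) ^ 2) by ring.
    apply Rabs_le_between in Hpos.
    assert (Hd : (1 - y ^ 2 - (1 - x ^ 2)) ^ 2 <= 9 * (y - x) ^ 2).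
    { replace ((1 - y ^ 2 - (1 - x ^ 2)) ^ 2) with ((x + y) ^ 2 * (y - x) ^ 2)
        by ring. now apply Rmult_le_compat_r. }
    assert (Hx2 : 0 <= 1 - x ^ 2 <= 1).
    { pose proof (pow2_ge_0 x). rewrite <- (pow2_abs x) in *.
      pose proof (Rabs_pos x). nra. }
    assert (0 <= (1 - x ^ 2) * (y - x) ^ 2 <= (y - x) ^ 2) by nra.
    apply Rabs_le. lra.
Qed.

Lemma envelope_lipschitz x y :
  Rabs (y - x) <= 1 -> Rabs (envelope y - envelope x) <= 15 * Rabs (y - x).
Proof.
  intros H. pose proof (envelope_taylor x y H) as Ht.
  assert (Hg : Rabs (4 * Rmax (1 - x ^ 2) 0 * x) <= 4).
  { destruct (Rle_lt_dec 1 (Rabs x)) as [Hx|Hx].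
    - rewrite <- (pow2_abs x), Rmax_right by nra.
      rewrite Rmult_0_r, Rmult_0_l, Rabs_R0. lra.
    - apply Rabs_def2 in Hx. apply Rabs_le. unfold Rmax. destruct Rle_dec; nra. }
  replace (envelope y - envelope x)
    with ((envelope y - envelope x + 4 * Rmax (1 - x ^ 2) 0 * x * (y - x))
          - 4 * Rmax (1 - x ^ 2) 0 * x * (y - x)) by ring.
  eapply Rle_trans; [apply Rabs_triang|].
  rewrite Rabs_Ropp, (Rabs_mult _ (y - x)).
  rewrite <- (pow2_abs (y - x)) in Ht. pose proof (Rabs_pos (y - x)). nra.
Qed.

Lemma envelope_second_difference x s :
  Rabs s <= 1 ->
  Rabs (envelope (x + s) - 2 * envelope x + envelope (x - s)) <= 22 * s ^ 2.
Proof.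
  intros H.
  assert (H1 := envelope_taylor x (x + s)). assert (H2 := envelope_taylor x (x - s)).
  replace (x + s - x) with s in H1 by ring.
  replace (x - s - x) with (- s) in H2 by ring.
  rewrite Rabs_Ropp in H2. specialize (H1 H). specialize (H2 H).
  apply Rabs_le_between in H1. apply Rabs_le_between in H2.
  apply Rabs_le. nra.
Qed.

(** With [c = cos] and [s = sin] sampled at the frequency whose discrete
    symbol is [sigma], the operator [lop] annihilates [c] and [s]; averaging
    over the four phases removes all terms linear in them. *)
Section FourPhases.

Context (e sigma kappa k beta : R) (eta c s : Z -> R) (gamma tau : R).
Context (He : 0 < e) (Hsigma : 0 < sigma) (Hk : 0 < k) (Hbeta : 0 <= beta <= 1).
Context (Hgamma : gamma = 1 - sigma * e ^ 2 / 2).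
Context (Hgt : gamma ^ 2 + tau ^ 2 = 1) (Hcs : forall i, c i ^ 2 + s i ^ 2 = 1).
Context (Hc : forall i, c (i + 1)%Z = gamma * c i - tau * s i).
Context (Hs : forall i, s (i + 1)%Z = gamma * s i + tau * c i).

Definition modulated (C : Z -> R) (i : Z) : R := eta i * (beta + C i).

(** Up to a factor, the energy density left after optimising [w >= 0] for
    [v = phi / k]; that optimum is [w = phi^+]. *)
Definition test_density (phi : Z -> R) (i : Z) : R :=
  lop e sigma phi i ^ 2 + kappa * phi i ^ 2 - k * Rmax (phi i) 0 ^ 2.

(** [c] and [s] are the real and imaginary parts of a character, and this is
    the squared modulus of [lop] applied to [eta] times that character, which
    [lop] annihilates: only differences of [eta] survive. *)
Lemma modulated_lop_square i :
  lop e sigma (fun j => eta j * c j) i ^ 2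
  + lop e sigma (fun j => eta j * s j) i ^ 2
  = gamma ^ 2 * ld e (ld e eta) i ^ 2
    + tau ^ 2 * ((eta (i + 2)%Z - eta i) / e ^ 2) ^ 2.
Proof.
  set (x := c (i + 1)%Z). set (y := s (i + 1)%Z).
  assert (Ec2 : c (i + 2)%Z = gamma * x - tau * y).
  { replace (i + 2)%Z with (i + 1 + 1)%Z by lia. apply Hc. }
  assert (Es2 : s (i + 2)%Z = gamma * y + tau * x).
  { replace (i + 2)%Z with (i + 1 + 1)%Z by lia. apply Hs. }
  assert (Ec0 : c i = gamma * x + tau * y).
  { transitivity ((gamma ^ 2 + tau ^ 2) * c i); [rewrite Hgt; ring|].
    unfold x, y. rewrite Hc, Hs. ring. }
  assert (Es0 : s i = gamma * y - tau * x).
  { transitivity ((gamma ^ 2 + tau ^ 2) * s i); [rewrite Hgt; ring|].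
    unfold x, y. rewrite Hc, Hs. ring. }
  assert (Hxy : x ^ 2 + y ^ 2 = 1) by apply Hcs.
  set (p := eta (i + 2)%Z). set (q := eta (i + 1)%Z). set (r := eta i).
  assert (D : ld e (ld e eta) i = (p - 2 * q + r) / e ^ 2).
  { unfold ld, p, q, r. replace (i + 1 + 1)%Z with (i + 2)%Z by lia. field. lra. }
  assert (L1 : lop e sigma (fun j => eta j * c j) i
     = gamma * x * ((p - 2 * q + r) / e ^ 2) - tau * y * ((p - r) / e ^ 2)).
  { unfold lop, ld. replace (i + 1 + 1)%Z with (i + 2)%Z by lia.
    fold x p q r. rewrite Ec2, Ec0.
    replace sigma with (2 * (1 - gamma) / e ^ 2) by (rewrite Hgamma; field; lra).
    field. lra. }
  assert (L2 : lop e sigma (fun j => eta j * s j) i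
     = gamma * y * ((p - 2 * q + r) / e ^ 2) + tau * x * ((p - r) / e ^ 2)).
  { unfold lop, ld. replace (i + 1 + 1)%Z with (i + 2)%Z by lia.
    fold y p q r. rewrite Es2, Es0.
    replace sigma with (2 * (1 - gamma) / e ^ 2) by (rewrite Hgamma; field; lra).
    field. lra. }
  rewrite L1, L2, D.
  set (A := (p - 2 * q + r) / e ^ 2). set (B := (p - r) / e ^ 2).
  transitivity ((x ^ 2 + y ^ 2) * (gamma ^ 2 * A ^ 2 + tau ^ 2 * B ^ 2)); [ring|].
  rewrite Hxy. ring.
Qed.

(** The chord of the convex function [C -> (beta + C)^-] over [[-1, 1]] is
    [(1 - beta) (1 - C) / 2]. *)
Lemma positive_part_lower_bound h C :
  0 <= h -> -1 <= C <= 1 ->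
  (h * (beta + C)) ^ 2 - ((1 - beta) / 2) ^ 2 * h ^ 2 * (1 - C) ^ 2
  <= Rmax (h * (beta + C)) 0 ^ 2.
Proof.
  intros Hh HC. unfold Rmax. destruct Rle_dec as [Hle|Hgt'].
  - set (u := (1 - beta) / 2 * (1 - C)).
    assert (Hu : 0 <= h * u) by (unfold u; apply Rmult_le_pos; [lra|apply Rmult_le_pos; lra]).
    assert (Hu' : - (h * (beta + C)) <= h * u).
    { unfold u. assert (- (beta + C) <= (1 - beta) / 2 * (1 - C)) by nra. nra. }
    replace (((1 - beta) / 2) ^ 2 * h ^ 2 * (1 - C) ^ 2) with ((h * u) ^ 2)
      by (unfold u; field). nra.
  - assert (0 <= ((1 - beta) / 2) ^ 2 * h ^ 2 * (1 - C) ^ 2); [|lra].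
    apply Rmult_le_pos; [apply Rmult_le_pos|]; apply pow2_ge_0.
Qed.

(** The coefficients of the two squares of [eta] add up to
    [- 4 (sigma^2/2 - beta^2 b - b/2 - 3/8 k (1 - beta)^2)] when
    [kappa = a - sigma ^ 2] and [k = a - b]; the remaining terms involve
    differences of [eta] and are small for a wide envelope. *)
Lemma four_phase_density D1 D2 i :
  sigma * e ^ 2 <= 4 -> 0 <= D2 ->
  (forall j, 0 <= eta j <= 1) ->
  Rabs (ld e (ld e eta) i) <= D2 ->
  Rabs ((eta (i + 2)%Z - eta i) / e) <= D1 ->
  test_density (modulated c) i + test_density (modulated (fun j => - c j)) i
  + test_density (modulated s) i + test_density (modulated (fun j => - s j)) i
  <= 4 * beta ^ 2 * sigma ^ 2 * eta (i + 1)%Z ^ 2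
     + ((kappa - k) * (4 * beta ^ 2 + 2)
        + 3 / 2 * k * (1 - beta) ^ 2) * eta i ^ 2
     + (8 * sigma * D2 + 6 * D2 ^ 2 + 2 * sigma * D1 ^ 2).
Proof.
  intros Hse HD2 Heta H2 H1.
  assert (Lp : forall C, lop e sigma (modulated C) i
     = beta * lop e sigma eta i + lop e sigma (fun j => eta j * C j) i).
  { intros C. unfold modulated, lop, ld. field. lra. }
  assert (Lm : forall C, lop e sigma (fun j => eta j * - C j) i
     = - lop e sigma (fun j => eta j * C j) i).
  { intros C. unfold lop, ld. field. lra. }
  unfold test_density.
  rewrite (Lp c), (Lp s), (Lp (fun j => - c j)), (Lp (fun j => - s j)).
  rewrite (Lm c), (Lm s).
  pose proof (modulated_lop_square i) as Hsq.
  set (X := lop e sigma (fun j => eta j * c j) i) in *.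
  set (Y := lop e sigma (fun j => eta j * s j) i) in *.
  assert (Ht : tau ^ 2 * ((eta (i + 2)%Z - eta i) / e ^ 2) ^ 2 <= sigma * D1 ^ 2).
  { replace (tau ^ 2 * ((eta (i + 2)%Z - eta i) / e ^ 2) ^ 2)
      with ((tau ^ 2 / e ^ 2) * ((eta (i + 2)%Z - eta i) / e) ^ 2) by (field; lra).
    assert (Et : tau ^ 2 / e ^ 2 = sigma * (1 - sigma * e ^ 2 / 4)).
    { replace (tau ^ 2) with (1 - gamma ^ 2) by lra. rewrite Hgamma. field. lra. }
    rewrite Et.
    assert (((eta (i + 2)%Z - eta i) / e) ^ 2 <= D1 ^ 2).
    { rewrite <- pow2_abs. apply pow_incr. split; [apply Rabs_pos | assumption]. }
    assert (0 < e ^ 2) by now apply pow_lt.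
    pose proof (pow2_ge_0 ((eta (i + 2)%Z - eta i) / e)).
    apply Rmult_le_compat; nra. }
  assert (HD : ld e (ld e eta) i ^ 2 <= D2 ^ 2).
  { rewrite <- pow2_abs. apply pow_incr. split; [apply Rabs_pos | assumption]. }
  assert (Hg : gamma ^ 2 * ld e (ld e eta) i ^ 2 <= D2 ^ 2).
  { pose proof (pow2_ge_0 tau). pose proof (pow2_ge_0 (ld e (ld e eta) i)). nra. }
  assert (HL : lop e sigma eta i ^ 2
     <= sigma ^ 2 * eta (i + 1)%Z ^ 2 + 2 * sigma * D2 + D2 ^ 2).
  { unfold lop. destruct (Heta (i + 1)%Z) as [Ha Hb].
    apply Rabs_le_between in H2.
    assert (sigma * (ld e (ld e eta) i * eta (i + 1)%Z) <= sigma * D2)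
      by (apply Rmult_le_compat_l; nra). nra. }
  assert (Hb2 : 0 <= beta ^ 2 <= 1) by nra.
  assert (HLb : beta ^ 2 * lop e sigma eta i ^ 2
     <= beta ^ 2 * sigma ^ 2 * eta (i + 1)%Z ^ 2 + 2 * sigma * D2 + D2 ^ 2).
  { assert (0 <= sigma * D2) by (apply Rmult_le_pos; lra).
    pose proof (pow2_ge_0 D2). nra. }
  assert (Hc1 : -1 <= c i <= 1) by (specialize (Hcs i); nra).
  assert (Hs1 : -1 <= s i <= 1) by (specialize (Hcs i); nra).
  assert (Hpc := positive_part_lower_bound (eta i) (c i) (proj1 (Heta i)) Hc1).
  assert (Hps := positive_part_lower_bound (eta i) (s i) (proj1 (Heta i)) Hs1).
  assert (Hpc' := positive_part_lower_bound (eta i) (- c i) (proj1 (Heta i)) ltac:(lra)).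
  assert (Hps' := positive_part_lower_bound (eta i) (- s i) (proj1 (Heta i)) ltac:(lra)).
  unfold modulated. specialize (Hcs i).
  set (h := eta i) in *.
  set (Pc := Rmax (h * (beta + c i)) 0 ^ 2) in *.
  set (Ps := Rmax (h * (beta + s i)) 0 ^ 2) in *.
  set (Pc' := Rmax (h * (beta + - c i)) 0 ^ 2) in *.
  set (Ps' := Rmax (h * (beta + - s i)) 0 ^ 2) in *.
  assert (HP : h ^ 2 * (4 * beta ^ 2 + 2) - 3 / 2 * (1 - beta) ^ 2 * h ^ 2
     <= Pc + Ps + Pc' + Ps').
  { apply Rle_trans with
     ((h * (beta + c i)) ^ 2 - ((1 - beta) / 2) ^ 2 * h ^ 2 * (1 - c i) ^ 2
     + ((h * (beta + s i)) ^ 2 - ((1 - beta) / 2) ^ 2 * h ^ 2 * (1 - s i) ^ 2)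
     + ((h * (beta + - c i)) ^ 2 - ((1 - beta) / 2) ^ 2 * h ^ 2 * (1 - - c i) ^ 2)
     + ((h * (beta + - s i)) ^ 2 - ((1 - beta) / 2) ^ 2 * h ^ 2 * (1 - - s i) ^ 2));
      [|lra].
    apply Req_le. replace (s i ^ 2) with (1 - c i ^ 2) by lra.
    match goal with |- _ = ?rhs => replace rhs with
      (h ^ 2 * (4 * beta ^ 2 + 2 * (c i ^ 2 + s i ^ 2))
       - ((1 - beta) / 2) ^ 2 * h ^ 2 * (4 + 2 * (c i ^ 2 + s i ^ 2))) by field end.
    rewrite Hcs. field. }
  assert (HkP : k * (h ^ 2 * (4 * beta ^ 2 + 2) - 3 / 2 * (1 - beta) ^ 2 * h ^ 2)
     <= k * (Pc + Ps + Pc' + Ps')) by (apply Rmult_le_compat_l; lra).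
  assert (Hq : kappa * (h * (beta + c i)) ^ 2 + kappa * (h * (beta + - c i)) ^ 2
     + kappa * (h * (beta + s i)) ^ 2 + kappa * (h * (beta + - s i)) ^ 2
     = kappa * h ^ 2 * (4 * beta ^ 2 + 2)).
  { transitivity (kappa * h ^ 2 * (4 * beta ^ 2 + 2 * (c i ^ 2 + s i ^ 2)));
      [ring | rewrite Hcs; ring]. }
  nra.
Qed.

End FourPhases.

(** For [phi] of negative test density the pair [phi^+], [phi / k] has
    negative energy; the energy is quadratic, so normalising the mass keeps
    the sign. *)
Lemma negative_energy_of_test e sigma kappa k N phi d S :
  0 < e -> (0 < N)%nat -> 0 < kappa -> 0 < k -> 0 < d ->
  periodic N phi -> lint e N (test_density e sigma kappa k phi) <= - d ->
  lint e N (fun i => Rmax (phi i) 0) <= S ->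
  exists w v, admissible e N w v /\
    lenergy e sigma kappa k N w v <= - (d / (2 * k * S ^ 2)).
Proof.
  intros He HN Hkappa Hk Hd Hphi HT HS.
  set (p := fun i => Rmax (phi i) 0) in *.
  assert (Hp : periodic N p) by now apply (periodic_map N (fun x => Rmax x 0)).
  assert (Hp0 : forall i, 0 <= p i) by (intros; apply Rmax_r).
  set (M := lint e N p) in *.
  assert (HM : 0 < M).
  { apply Rnot_le_lt. intro Hle.
    assert (0 <= lint e N (test_density e sigma kappa k phi)); [|lra].
    apply lint_nonneg; [assumption|]. intros i. unfold test_density.
    fold (p i). rewrite (lint_zero e N He HN p i Hp Hp0 Hle).
    pose proof (pow2_ge_0 (lop e sigma phi i)). pose proof (pow2_ge_0 (phi i)). nra. }
  exists (fun i => / M * p i), (fun i => / (k * M) * phi i). split.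
  - repeat split.
    + now apply (periodic_map N (fun x => / M * x)).
    + intros i. apply Rmult_le_pos; [|apply Hp0].
      now apply Rlt_le, Rinv_0_lt_compat.
    + rewrite lint_scal. fold M. field. lra.
    + now apply (periodic_map N (fun x => / (k * M) * x)).
  - unfold lenergy.
    rewrite (lint_ext e N _ (fun i => / (2 * k * M ^ 2) * test_density e sigma kappa k phi i)).
    + rewrite lint_scal.
      assert (HM2 : 0 < M ^ 2) by now apply pow_lt.
      assert (HMS : M ^ 2 <= S ^ 2) by (apply pow_incr; lra).
      apply Rle_trans with (/ (2 * k * M ^ 2) * - d).
      * apply Rmult_le_compat_l; [|assumption].
        apply Rlt_le, Rinv_0_lt_compat. nra.
      * assert (/ (2 * k * S ^ 2) <= / (2 * k * M ^ 2)).
        { apply Rinv_le_contravar; nra. }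
        unfold Rdiv. nra.
    + intros i. unfold test_density. fold (p i).
      assert (E : lop e sigma (fun i => / (k * M) * phi i) i
                  = / (k * M) * lop e sigma phi i)
        by (unfold lop, ld; field; lra).
      rewrite E.
      assert (Hpp : p i * phi i = p i ^ 2).
      { unfold p, Rmax. destruct Rle_dec; ring. }
      replace (k * (/ M * p i * (/ (k * M) * phi i)))
        with (/ M ^ 2 * (p i * phi i)) by (field; lra).
      rewrite Hpp. field. lra.
Qed.

Lemma up_to_nat r : 0 < r -> r < INR (Z.to_nat (up r)) <= r + 1.
Proof.
  intros Hr. destruct (archimed r) as [H1 H2].
  assert (0 < up r)%Z by (apply lt_IZR; lra).
  rewrite INR_IZR_INZ, Z2Nat.id by lia. lra.
Qed.

Lemma psum_truncate f m n :
  (m <= n)%nat -> (forall i, (Z.of_nat m <= i)%Z -> f i = 0) ->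
  psum f n = psum f m.
Proof.
  intros Hmn Hf. replace n with (m + (n - m))%nat by lia.
  rewrite psum_split, (psum_ext (fun i => f (i + Z.of_nat m)%Z) (fun _ => 0)).
  - rewrite psum_const. ring.
  - intros i Hi. apply Hf. lia.
Qed.

Lemma scaled_envelope_differences e R0 x :
  0 < e <= 1 -> 1 <= R0 ->
  Rabs ((envelope ((x + e) / R0) - 2 * envelope (x / R0)
         + envelope ((x - e) / R0)) / e ^ 2) <= 22 / R0 ^ 2 /\
  Rabs ((envelope ((x + e) / R0) - envelope ((x - e) / R0)) / e) <= 30 / R0.
Proof.
  intros [He He1] HR.
  assert (Hs : 0 < e / R0 <= 1).
  { split; [apply Rdiv_lt_0_compat; lra|].
    apply Rmult_le_reg_l with R0; [lra|].
    replace (R0 * (e / R0)) with e by (field; lra). lra. }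
  assert (Hs' : Rabs (e / R0) <= 1) by (rewrite Rabs_pos_eq; lra).
  pose proof (envelope_second_difference (x / R0) (e / R0) Hs') as H2.
  assert (HL1 := envelope_lipschitz (x / R0) ((x + e) / R0)).
  assert (HL2 := envelope_lipschitz (x / R0) ((x - e) / R0)).
  replace ((x + e) / R0 - x / R0) with (e / R0) in HL1 by (field; lra).
  replace ((x - e) / R0 - x / R0) with (- (e / R0)) in HL2 by (field; lra).
  rewrite Rabs_Ropp in HL2.
  specialize (HL1 Hs'). specialize (HL2 Hs').
  rewrite (Rabs_pos_eq (e / R0)) in HL1, HL2 by lra.
  replace (x / R0 + e / R0) with ((x + e) / R0) in H2 by (field; lra).
  replace (x / R0 - e / R0) with ((x - e) / R0) in H2 by (field; lra).
  set (A := envelope ((x + e) / R0)) in *. set (B := envelope (x / R0)) in *.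
  set (C := envelope ((x - e) / R0)) in *.
  assert (He2 : 0 < e ^ 2) by now apply pow_lt.
  split.
  - unfold Rdiv at 1. rewrite Rabs_mult, (Rabs_pos_eq (/ e ^ 2))
      by (apply Rlt_le, Rinv_0_lt_compat; lra).
    apply Rmult_le_reg_r with (e ^ 2); [lra|].
    rewrite Rmult_assoc, Rinv_l by lra.
    replace (22 / R0 ^ 2 * e ^ 2) with (22 * (e / R0) ^ 2) by (field; lra). lra.
  - unfold Rdiv at 1. rewrite Rabs_mult, (Rabs_pos_eq (/ e))
      by (apply Rlt_le, Rinv_0_lt_compat; lra).
    apply Rmult_le_reg_r with e; [lra|].
    rewrite Rmult_assoc, Rinv_l by lra.
    replace (30 / R0 * e) with (30 * (e / R0)) by (field; lra).
    apply Rabs_le_between in HL1. apply Rabs_le_between in HL2.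
    rewrite Rmult_1_r. apply Rabs_le. lra.
Qed.

(** One of the four phases does at least as well as their average. The bump
    vanishes near both ends of the period, so its periodic extension has the
    same energy. *)
Lemma negative_energy_state sigma a b beta :
  0 < sigma -> sigma ^ 2 < a -> 0 < b < a -> 0 <= beta <= 1 ->
  beta ^ 2 * b + b / 2 + 3 / 8 * (a - b) * (1 - beta) ^ 2 < sigma ^ 2 / 2 ->
  exists m0 L e1, 0 < m0 /\ 0 < e1 /\ forall e N,
    0 < e <= e1 -> L <= INR N * e ->
    exists w v, admissible e N w v /\
      lenergy e sigma (a - sigma ^ 2) (a - b) N w v <= - m0.
Proof.
  intros Hsigma Ha Hb Hbeta Hneg.
  set (k := a - b). set (kappa := a - sigma ^ 2).
  assert (Hk : 0 < k) by (unfold k; lra).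
  assert (Hkappa : 0 < kappa) by (unfold kappa; lra).
  set (d := sigma ^ 2 / 2 - (beta ^ 2 * b + b / 2 + 3 / 8 * k * (1 - beta) ^ 2)).
  assert (Hd : 0 < d) by (unfold d, k; lra).
  (* the errors caused by the slow modulation are of order [K / R0 ^ 2] on an
     interval of length about [2 R0], against a gain of order [d R0] *)
  set (K := 1976 * sigma + 2904).
  assert (HK : 0 < K) by (unfold K; lra).
  set (R0 := 2 + 20 * K / d).
  assert (HR : 2 <= R0).
  { unfold R0. assert (0 < 20 * K / d) by (apply Rdiv_lt_0_compat; lra). lra. }
  assert (HKd : 20 * K <= d * R0).
  { unfold R0. replace (d * (2 + 20 * K / d)) with (2 * d + 20 * K)
      by (field; lra). lra. }
  set (S0 := 2 * (2 * R0 + 5)).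
  exists (d / 8 / (2 * k * S0 ^ 2)), (2 * R0 + 8), (Rmin 1 (4 / sigma)).
  assert (HS0 : 0 < S0) by (unfold S0; lra).
  split; [|split].
  { apply Rdiv_lt_0_compat; [lra|]. assert (0 < S0 ^ 2) by now apply pow_lt. nra. }
  { apply Rmin_glb_lt; [lra|]. apply Rdiv_lt_0_compat; lra. }
  intros e N [He He1] HL.
  assert (Hle1 : e <= 1) by (apply Rle_trans with (1 := He1), Rmin_l).
  assert (Hse : sigma * e ^ 2 <= 4).
  { assert (He4 : e <= 4 / sigma) by (apply Rle_trans with (1 := He1), Rmin_r).
    assert (sigma * e <= 4).
    { apply Rmult_le_compat_l with (r := sigma) in He4; [|lra].
      replace (sigma * (4 / sigma)) with 4 in He4 by (field; lra). lra. }
    assert (0 < sigma * e) by nra. nra. }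
  set (gamma := 1 - sigma * e ^ 2 / 2).
  assert (He2 : 0 < e ^ 2) by now apply pow_lt.
  assert (Hgamma : -1 <= gamma <= 1) by (unfold gamma; nra).
  set (theta := acos gamma).
  assert (Hcos : cos theta = gamma) by now apply cos_acos.
  set (c := fun i : Z => cos (theta * IZR i)).
  set (s := fun i : Z => sin (theta * IZR i)).
  set (eta := fun i : Z => envelope ((e * IZR i - (R0 + 2)) / R0)).
  assert (Hcs : forall i, c i ^ 2 + s i ^ 2 = 1).
  { intros i. unfold c, s. rewrite <- (sin2_cos2 (theta * IZR i)).
    unfold Rsqr. ring. }
  assert (Hc : forall i, c (i + 1)%Z = gamma * c i - sin theta * s i).
  { intros i. unfold c, s. rewrite plus_IZR, Rmult_plus_distr_l, Rmult_1_r,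
      cos_plus, Hcos. ring. }
  assert (Hs : forall i, s (i + 1)%Z = gamma * s i + sin theta * c i).
  { intros i. unfold c, s. rewrite plus_IZR, Rmult_plus_distr_l, Rmult_1_r,
      sin_plus, Hcos. ring. }
  assert (Hgt : gamma ^ 2 + sin theta ^ 2 = 1).
  { rewrite <- Hcos, <- (sin2_cos2 theta). unfold Rsqr. ring. }
  assert (Heta : forall i, 0 <= eta i <= 1) by (intros; apply envelope_bounds).
  set (n1 := Z.to_nat (up ((2 * R0 + 4) / e))).
  assert (Hn1 : 2 * R0 + 4 < e * INR n1 <= 2 * R0 + 4 + e).
  { destruct (up_to_nat ((2 * R0 + 4) / e)) as [H1 H2].
    - apply Rdiv_lt_0_compat; lra.
    - fold n1 in H1, H2.
      apply Rmult_lt_compat_l with (r := e) in H1; [|lra].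
      apply Rmult_le_compat_l with (r := e) in H2; [|lra].
      rewrite Rmult_plus_distr_l in H2.
      replace (e * ((2 * R0 + 4) / e)) with (2 * R0 + 4) in * by (field; lra). lra. }
  assert (HnN : (n1 <= N)%nat).
  { apply INR_le. apply Rmult_le_reg_l with e; [lra|]. lra. }
  assert (Hn12 : (2 <= n1)%nat).
  { apply INR_le. simpl. apply Rmult_le_reg_l with e; lra. }
  assert (Heta_hi : forall i, (Z.of_nat n1 <= i)%Z -> eta i = 0).
  { intros i Hi. unfold eta. apply envelope_outside.
    apply IZR_le in Hi. rewrite <- INR_IZR_INZ in Hi.
    assert (2 * R0 + 4 < e * IZR i) by nra.
    rewrite Rabs_pos_eq.
    - apply Rmult_le_reg_r with R0; [lra|].
      unfold Rdiv. rewrite Rmult_assoc, Rinv_l by lra. lra.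
    - apply Rlt_le, Rdiv_lt_0_compat; lra. }
  assert (Heta_lo : forall i, (i <= 1)%Z -> eta i = 0).
  { intros i Hi. unfold eta. apply envelope_outside.
    apply IZR_le in Hi.
    assert (e * IZR i <= 1) by nra.
    rewrite Rabs_left.
    - apply Rmult_le_reg_r with R0; [lra|].
      unfold Rdiv. rewrite Ropp_mult_distr_l, Rmult_assoc, Rinv_l by lra. lra.
    - unfold Rdiv. apply Rmult_lt_reg_r with R0; [lra|].
      rewrite Rmult_assoc, Rinv_l by lra. lra. }
  assert (Hdiff : forall i, Rabs (ld e (ld e eta) i) <= 22 / R0 ^ 2 /\
                  Rabs ((eta (i + 2)%Z - eta i) / e) <= 30 / R0).
  { intros i.
    destruct (scaled_envelope_differences e R0 (e * IZR (i + 1) - (R0 + 2)))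
      as [H2 H1]; [lra | lra |].
    replace ((e * IZR (i + 1) - (R0 + 2) + e) / R0)
      with ((e * IZR (i + 2) - (R0 + 2)) / R0) in * by (rewrite !plus_IZR; field; lra).
    replace ((e * IZR (i + 1) - (R0 + 2) - e) / R0)
      with ((e * IZR i - (R0 + 2)) / R0) in * by (rewrite !plus_IZR; field; lra).
    fold (eta (i + 2)%Z) (eta (i + 1)%Z) (eta i) in H1, H2.
    split; [|exact H1].
    replace (ld e (ld e eta) i)
      with ((eta (i + 2)%Z - 2 * eta (i + 1)%Z + eta i) / e ^ 2); [exact H2|].
    unfold ld. replace (i + 1 + 1)%Z with (i + 2)%Z by lia. field. lra. }
  assert (HR2 : 0 < R0 ^ 2) by (apply pow_lt; lra).
  set (T := fun C => psum (test_density e sigma kappa k (modulated beta eta C)) n1).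
  assert (Hsum : e * (T c + T (fun j => - c j) + T s + T (fun j => - s j))
                 <= - (d / 2)).
  { unfold T. rewrite <- !psum_plus.
    set (E := K / R0 ^ 2).
    set (q := psum (fun i => eta i ^ 2) n1).
    assert (Hq : R0 / 8 <= e * q).
    { set (m := Z.to_nat (up ((R0 / 2 + 2) / e))).
      set (n := (Z.to_nat (up (R0 / e)) - 1)%nat).
      assert (Hm : R0 / 2 + 2 < e * INR m <= R0 / 2 + 2 + e).
      { destruct (up_to_nat ((R0 / 2 + 2) / e)) as [H1 H2].
        - apply Rdiv_lt_0_compat; lra.
        - fold m in H1, H2.
          apply Rmult_lt_compat_l with (r := e) in H1; [|lra].
          apply Rmult_le_compat_l with (r := e) in H2; [|lra].
          rewrite Rmult_plus_distr_l in H2.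
          replace (e * ((R0 / 2 + 2) / e)) with (R0 / 2 + 2) in * by (field; lra).
          lra. }
      assert (Hn : R0 - e < e * INR n <= R0).
      { destruct (up_to_nat (R0 / e)) as [H1 H2].
        - apply Rdiv_lt_0_compat; lra.
        - assert (1 <= Z.to_nat (up (R0 / e)))%nat.
          { apply INR_le. simpl. apply Rlt_le, Rle_lt_trans with (2 := H1).
            apply Rmult_le_reg_l with e; [lra|].
            replace (e * (R0 / e)) with R0 by (field; lra). lra. }
          assert (En : INR (Z.to_nat (up (R0 / e))) = INR n + 1).
          { unfold n. rewrite minus_INR by assumption. simpl. ring. }
          rewrite En in H1, H2.
          apply Rmult_lt_compat_l with (r := e) in H1; [|lra].
          apply Rmult_le_compat_l with (r := e) in H2; [|lra].
          rewrite Rmult_plus_distr_l in H1. rewrite !Rmult_plus_distr_l in H2.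
          replace (e * (R0 / e)) with R0 in * by (field; lra). lra. }
      assert (Hmn : (m + n <= n1)%nat).
      { apply INR_le. rewrite plus_INR. apply Rmult_le_reg_l with e; lra. }
      assert (Hqn : INR n * (1 / 4) <= q).
      { unfold q.
        apply Rle_trans with (psum (fun i => eta i ^ 2) (m + n)).
        - rewrite psum_split, <- psum_const.
          pose proof (psum_nonneg (fun i => eta i ^ 2) m (fun i _ => pow2_ge_0 _)).
          apply Rle_trans with (psum (fun i => eta (i + Z.of_nat m)%Z ^ 2) n); [|lra].
          apply psum_le. intros i Hi.
          assert (1 / 2 <= eta (i + Z.of_nat m)%Z); [|nra].
          apply envelope_center. rewrite plus_IZR, <- INR_IZR_INZ.
          destruct Hi as [Hi1 Hi2]. apply IZR_le in Hi1.
          assert (Hi3 : (i <= Z.of_nat n - 1)%Z) by lia.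
          apply IZR_le in Hi3. rewrite minus_IZR, <- INR_IZR_INZ in Hi3.
          assert (0 <= e * IZR i) by nra.
          assert (e * IZR i <= e * INR n - e) by nra.
          unfold Rdiv at 1. rewrite Rabs_mult, (Rabs_pos_eq (/ R0))
            by (apply Rlt_le, Rinv_0_lt_compat; lra).
          apply Rmult_le_reg_r with R0; [lra|].
          rewrite Rmult_assoc, Rinv_l by lra.
          apply Rle_trans with (R0 / 2); [|lra].
          rewrite Rmult_1_r. apply Rabs_le. lra.
        - apply psum_mono; [intros; apply pow2_ge_0 | assumption]. }
      nra. }
    assert (Hshift : psum (fun i => eta (i + 1)%Z ^ 2) n1 = q).
    { assert (Hgen : forall n, psum (fun i => eta (i + 1)%Z ^ 2) n
        = psum (fun i => eta i ^ 2) n + eta (Z.of_nat n) ^ 2 - eta 0%Z ^ 2).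
      { induction n as [|n IH]; [simpl; ring|]. cbn [psum]. rewrite IH.
        replace (Z.of_nat n + 1)%Z with (Z.of_nat (S n)) by lia. ring. }
      rewrite Hgen, Heta_hi, Heta_lo by lia. unfold q. ring. }
    assert (HE : 8 * sigma * (22 / R0 ^ 2) + 6 * (22 / R0 ^ 2) ^ 2
                 + 2 * sigma * (30 / R0) ^ 2 <= E).
    { unfold E, K.
      replace ((1976 * sigma + 2904) / R0 ^ 2) with
        (8 * sigma * (22 / R0 ^ 2) + 2904 / R0 ^ 2 + 2 * sigma * (30 / R0) ^ 2)
        by (field; lra).
      assert (6 * (22 / R0 ^ 2) ^ 2 <= 2904 / R0 ^ 2); [|lra].
      replace (6 * (22 / R0 ^ 2) ^ 2) with (2904 / R0 ^ 2 * / R0 ^ 2) by (field; lra).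
      assert (0 < 2904 / R0 ^ 2) by (apply Rdiv_lt_0_compat; lra).
      assert (/ R0 ^ 2 <= 1).
      { rewrite <- Rinv_1. apply Rinv_le_contravar; nra. }
      nra. }
    apply Rle_trans with (e * psum (fun i =>
      4 * beta ^ 2 * sigma ^ 2 * eta (i + 1)%Z ^ 2
      + ((kappa - k) * (4 * beta ^ 2 + 2) + 3 / 2 * k * (1 - beta) ^ 2) * eta i ^ 2
      + E) n1).
    - apply Rmult_le_compat_l; [lra|]. apply psum_le. intros i _.
      assert (HD2 : 0 <= 22 / R0 ^ 2) by (apply Rlt_le, Rdiv_lt_0_compat; lra).
      eapply Rle_trans.
      + apply (four_phase_density e sigma kappa k beta eta c s gamma (sin theta)
          He Hsigma Hk Hbeta eq_refl Hgt Hcs Hc Hs (30 / R0) (22 / R0 ^ 2) i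
          Hse HD2 Heta (proj1 (Hdiff i)) (proj2 (Hdiff i))).
      + lra.
    - rewrite !psum_plus, !psum_scal, psum_const, Hshift. fold q.
      replace (e * (4 * beta ^ 2 * sigma ^ 2 * q +
         ((kappa - k) * (4 * beta ^ 2 + 2) + 3 / 2 * k * (1 - beta) ^ 2) * q
         + INR n1 * E)) with (- 4 * d * (e * q) + e * INR n1 * E)
        by (unfold d, kappa, k; field).
      assert (HER : E * R0 ^ 2 = K) by (unfold E; field; lra).
      assert (0 < E) by (unfold E; apply Rdiv_lt_0_compat; lra).
      assert (Hlen : e * INR n1 <= 5 * R0) by lra.
      assert (H5 : 5 * R0 * E <= d * R0 / 4).
      { apply Rmult_le_reg_r with R0; [lra|].
        replace (5 * R0 * E * R0) with (5 * K) by (rewrite <- HER; ring). nra. }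
      assert (e * INR n1 * E <= 5 * R0 * E) by (apply Rmult_le_compat_r; lra).
      nra. }
  assert (Hphase : exists C, (forall i, -1 <= C i <= 1) /\ e * T C <= - (d / 8)).
  { assert (Hc1 : forall i, -1 <= c i <= 1) by (intros i; specialize (Hcs i); nra).
    assert (Hs1 : forall i, -1 <= s i <= 1) by (intros i; specialize (Hcs i); nra).
    destruct (Rle_lt_dec (e * T c) (- (d / 8))); [now exists c|].
    destruct (Rle_lt_dec (e * T s) (- (d / 8))); [now exists s|].
    destruct (Rle_lt_dec (e * T (fun j => - c j)) (- (d / 8))).
    { exists (fun j => - c j). split; [|assumption]. intros i.
      specialize (Hc1 i). lra. }
    exists (fun j => - s j). split; [intros i; specialize (Hs1 i); lra|]. lra. }
  destruct Hphase as [C [HC HT]].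
  set (phi := modulated beta eta C) in *.
  assert (Hphi_hi : forall i, (Z.of_nat n1 <= i)%Z -> phi i = 0).
  { intros i Hi. unfold phi, modulated. rewrite Heta_hi by assumption. ring. }
  assert (Hphi_lo : forall i, (i <= 1)%Z -> phi i = 0).
  { intros i Hi. unfold phi, modulated. rewrite Heta_lo by assumption. ring. }
  assert (Hphi2 : forall i, Rmax (phi i) 0 <= 2).
  { intros i. unfold phi, modulated. specialize (Heta i). specialize (HC i).
    apply Rmax_lub; nra. }
  set (per := fun i : Z => phi (i mod Z.of_nat N)%Z).
  assert (Hper : forall i, (0 <= i < Z.of_nat N + 2)%Z -> per i = phi i).
  { intros i Hi. unfold per.
    destruct (Z_lt_le_dec i (Z.of_nat N)) as [Hlt|Hge].
    - now rewrite Z.mod_small by lia.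
    - rewrite (Hphi_hi i) by lia. apply Hphi_lo.
      replace i with ((i - Z.of_nat N) + 1 * Z.of_nat N)%Z at 1 by lia.
      rewrite Z_mod_plus_full, Z.mod_small; lia. }
  apply (negative_energy_of_test e sigma kappa k N per (d / 8) S0);
    try assumption; try lra; try lia.
  - intros i. unfold per. f_equal.
    replace (i + Z.of_nat N)%Z with (i + 1 * Z.of_nat N)%Z by lia.
    apply Z_mod_plus_full.
  - apply Rle_trans with (2 := HT). apply Req_le. unfold lint, T. f_equal. fold phi.
    rewrite <- (psum_truncate (test_density e sigma kappa k phi) n1 N HnN).
    + apply psum_ext. intros i Hi. unfold test_density, lop, ld.
      rewrite !Hper by lia. reflexivity.
    + intros i Hi. unfold test_density, lop, ld.
      rewrite !Hphi_hi by lia. rewrite Rmax_left by lra. field. lra.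
  - unfold lint.
    rewrite (psum_ext _ (fun i => Rmax (phi i) 0))
      by (intros i Hi; now rewrite Hper by lia).
    rewrite (psum_truncate (fun i => Rmax (phi i) 0) n1 N HnN).
    + apply Rle_trans with (e * (INR n1 * 2)).
      * apply Rmult_le_compat_l; [lra|]. rewrite <- psum_const.
        apply psum_le. intros; apply Hphi2.
      * unfold S0. lra.
    + intros i Hi. rewrite Hphi_hi by assumption. apply Rmax_left. lra.
Qed.

(** * From the lattice to the line *)

(** At the minimum the energy equals [- h / 2], so the test pair bounds [h]
    from below. *)
Lemma lattice_solutions_exist sigma a b beta :
  0 < sigma -> sigma ^ 2 < a -> 0 < b < a -> 0 <= beta <= 1 ->
  beta ^ 2 * b + b / 2 + 3 / 8 * (a - b) * (1 - beta) ^ 2 < sigma ^ 2 / 2 ->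
  exists h0 C L e1, 0 < h0 /\ 0 < C /\ 0 < e1 /\ forall e N,
    0 < e <= e1 -> L <= INR N * e ->
    exists w v h i0,
      lattice_solution e sigma (a - sigma ^ 2) (a - b) h N w v /\
      h0 <= h <= C /\ h <= (a - b) * v i0 /\
      lint e N (fun i => v i ^ 2) <= C /\
      forall i, Rabs (v i) <= C /\ Rabs (ld e v i) <= C /\
        Rabs (ld e (ld e v) i) <= C /\ Rabs (ld e (ld e (ld e v)) i) <= C /\
        Rabs (ld e (ld e (ld e (ld e v))) i) <= C.
Proof.
  intros Hsigma Ha Hb Hbeta Hneg.
  set (k := a - b). set (kappa := a - sigma ^ 2).
  assert (Hk : 0 < k) by (unfold k; lra).
  assert (Hkappa : 0 < kappa) by (unfold kappa; lra).
  destruct (negative_energy_state sigma a b beta Hsigma Ha Hb Hbeta Hneg)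
    as (m0 & L & e1 & Hm0 & He1 & Htest).
  destruct (lattice_uniform_bounds sigma kappa k Hsigma Hkappa Hk) as (C & HC & Hbd).
  exists (2 * m0), (C * (1 + k)), (Rmax L 1), e1.
  split; [lra|]. split; [nra|]. split; [assumption|].
  intros e N He HL.
  assert (HL1 : 1 <= INR N * e) by (apply Rle_trans with (2 := HL), Rmax_r).
  assert (HL2 : L <= INR N * e) by (apply Rle_trans with (2 := HL), Rmax_l).
  assert (HN : (0 < N)%nat).
  { apply INR_lt. simpl. apply Rnot_le_lt. intro. nra. }
  destruct (Htest e N He HL2) as (w0 & v0 & Hadm0 & Hlow).
  destruct He as [He _].
  destruct (lenergy_minimum_exists e sigma kappa k N He HN Hkappa Hk w0 v0 Hadm0)
    as (w & v & Hadm & Hmin).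
  pose proof (minimum_residual_zero e sigma kappa k N He HN Hk w v Hadm Hmin) as Hr.
  pose proof (minimum_complementarity e sigma kappa k N He HN w v Hadm Hmin) as Hc.
  set (h := lint e N (fun j => (k * v j - w j) * w j)) in *.
  destruct Hadm as (Hw & Hw0 & Hw1 & Hv).
  pose proof (minimum_quadratic_form e sigma kappa N He HN w v Hw Hv Hr) as HQ.
  assert (Hh : 2 * m0 <= h).
  { assert (E : h = - 2 * lenergy e sigma kappa k N w v).
    { unfold lenergy.
      rewrite (lint_ext e N (fun i => w i ^ 2 / 2 + k / 2 *
         (lop e sigma v i ^ 2 + kappa * v i ^ 2) - k * (w i * v i))
         (fun i => k / 2 * (lop e sigma v i ^ 2 + kappa * v i ^ 2)
                   - (k * (w i * v i) - / 2 * w i ^ 2))) by (intros; field).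
      rewrite lint_minus, lint_minus, !lint_scal, HQ.
      unfold h. rewrite (lint_ext e N _ (fun j => k * (w j * v j) - w j ^ 2))
        by (intros; ring).
      rewrite lint_minus, lint_scal. field. }
    fold k kappa in Hlow. pose proof (Hmin w0 v0 Hadm0). lra. }
  assert (Hsol : lattice_solution e sigma kappa k h N w v) by (repeat split; assumption).
  destruct (Hbd e h N w v He HN HL1 ltac:(lra) Hsol) as [Hv2 Hall].
  assert (Hi0 : exists i0, 0 < w i0).
  { apply NNPP. intro Hno.
    assert (lint e N w <= 0); [|lra].
    apply Rle_trans with (lint e N (fun _ => 0)).
    - apply lint_le; [assumption|]. intros i. apply Rnot_lt_le. intro.
      apply Hno. now exists i.
    - unfold lint. rewrite psum_const. lra. }
  destruct Hi0 as [i0 Hi0].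
  assert (HCk : C <= C * (1 + k)) by nra.
  exists w, v, h, i0. split; [assumption|]. split; [split; [assumption|]|].
  - apply Rle_trans with (k * C); [|nra].
    rewrite <- (Rmult_1_r (k * C)), <- Hw1, <- lint_scal.
    apply lint_le; [assumption|]. intros i.
    destruct (Hall i) as [Hvi _]. apply Rabs_le_between in Hvi.
    specialize (Hw0 i). assert (k * v i <= k * C) by nra. nra.
  - split; [|split; [lra|]].
    + rewrite Hc in Hi0. unfold Rmax in Hi0. destruct Rle_dec in Hi0; lra.
    + intros i. destruct (Hall i) as (B0 & B1 & B2 & B3 & B4).
      repeat split; lra.
Qed.

Lemma lattice_lipschitz e C f :
  0 < e -> (forall i, Rabs (ld e f i) <= C) ->
  forall i j, Rabs (f j - f i) <= C * Rabs (e * IZR (j - i)).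
Proof.
  intros He Hf.
  assert (Hn : forall n i, Rabs (f (i + Z.of_nat n)%Z - f i) <= C * (e * INR n)).
  { intros n i. induction n as [|n IH].
    - simpl. rewrite Z.add_0_r, Rminus_diag, Rabs_R0. lra.
    - replace (i + Z.of_nat (S n))%Z with (i + Z.of_nat n + 1)%Z by lia.
      rewrite S_INR.
      replace (f (i + Z.of_nat n + 1)%Z - f i)
        with (e * ld e f (i + Z.of_nat n)%Z + (f (i + Z.of_nat n)%Z - f i))
        by (unfold ld; field; lra).
      eapply Rle_trans; [apply Rabs_triang|].
      rewrite Rabs_mult, (Rabs_pos_eq e) by lra.
      specialize (Hf (i + Z.of_nat n)%Z). nra. }
  intros i j. rewrite Rabs_mult, (Rabs_pos_eq e) by lra.
  destruct (Z_le_gt_dec i j) as [H|H].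
  - specialize (Hn (Z.to_nat (j - i)) i).
    rewrite INR_IZR_INZ, Z2Nat.id in Hn by lia.
    replace (i + (j - i))%Z with j in Hn by lia.
    rewrite (Rabs_pos_eq (IZR (j - i))); [exact Hn|]. apply IZR_le. lia.
  - specialize (Hn (Z.to_nat (i - j)) j).
    rewrite INR_IZR_INZ, Z2Nat.id in Hn by lia.
    replace (j + (i - j))%Z with i in Hn by lia.
    rewrite Rabs_minus_sym in Hn.
    replace (Rabs (IZR (j - i))) with (IZR (i - j)); [exact Hn|].
    rewrite <- Rabs_Ropp, <- opp_IZR.
    replace (- (j - i))%Z with (i - j)%Z by lia.
    symmetry. apply Rabs_pos_eq, IZR_le. lia.
Qed.

Lemma lattice_taylor e M f :
  0 < e ->
  (forall i j, Rabs (ld e f j - ld e f i) <= M * Rabs (e * IZR (j - i))) ->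
  forall i j, Rabs (f j - f i - e * IZR (j - i) * ld e f i)
              <= 2 * M * (e * IZR (j - i)) ^ 2.
Proof.
  intros He HL.
  assert (HM : 0 <= M).
  { specialize (HL 0%Z 1%Z). rewrite Rabs_mult, (Rabs_pos_eq e) in HL by lra.
    simpl in HL. rewrite (Rabs_pos_eq 1) in HL by lra.
    pose proof (Rabs_pos (ld e f 1%Z - ld e f 0%Z)). nra. }
  assert (Hn : forall n i,
    Rabs (f (i + Z.of_nat n)%Z - f i - e * INR n * ld e f i) <= M * (e * INR n) ^ 2).
  { intros n i. induction n as [|n IH].
    - simpl. rewrite Z.add_0_r.
      replace (f i - f i - e * 0 * ld e f i) with 0 by ring. rewrite Rabs_R0. nra.
    - replace (i + Z.of_nat (S n))%Z with (i + Z.of_nat n + 1)%Z by lia.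
      rewrite S_INR.
      replace (f (i + Z.of_nat n + 1)%Z - f i - e * (INR n + 1) * ld e f i)
        with (e * (ld e f (i + Z.of_nat n)%Z - ld e f i)
              + (f (i + Z.of_nat n)%Z - f i - e * INR n * ld e f i))
        by (unfold ld; field; lra).
      eapply Rle_trans; [apply Rabs_triang|].
      rewrite Rabs_mult, (Rabs_pos_eq e) by lra.
      specialize (HL i (i + Z.of_nat n)%Z).
      replace (i + Z.of_nat n - i)%Z with (Z.of_nat n) in HL by lia.
      rewrite <- INR_IZR_INZ in HL. pose proof (pos_INR n) as Hpn.
      rewrite (Rabs_pos_eq (e * INR n)) in HL by nra.
      assert (e * Rabs (ld e f (i + Z.of_nat n)%Z - ld e f i)
              <= e * (M * (e * INR n))) by (apply Rmult_le_compat_l; lra).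
      assert (0 <= M * e ^ 2) by (apply Rmult_le_pos; [lra | apply pow2_ge_0]).
      nra. }
  intros i j. destruct (Z_le_gt_dec i j) as [H|H].
  - specialize (Hn (Z.to_nat (j - i)) i).
    rewrite INR_IZR_INZ, Z2Nat.id in Hn by lia.
    replace (i + (j - i))%Z with j in Hn by lia.
    apply Rle_trans with (1 := Hn).
    pose proof (pow2_ge_0 (e * IZR (j - i))). nra.
  - specialize (Hn (Z.to_nat (i - j)) j).
    rewrite INR_IZR_INZ, Z2Nat.id in Hn by lia.
    replace (j + (i - j))%Z with i in Hn by lia.
    specialize (HL j i).
    replace (IZR (j - i)) with (- IZR (i - j))
      by (rewrite <- opp_IZR; f_equal; lia).
    set (t := e * IZR (i - j)) in *.
    assert (Ht : 0 <= t) by (unfold t; apply Rmult_le_pos; [lra | apply IZR_le; lia]).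
    rewrite (Rabs_pos_eq t Ht) in HL.
    replace (e * - IZR (i - j)) with (- t) by (unfold t; ring).
    replace (f j - f i - - t * ld e f i)
      with (t * (ld e f i - ld e f j) - (f i - f j - t * ld e f j)) by ring.
    apply Rabs_le_between in HL. apply Rabs_le_between in Hn.
    assert (- (M * t ^ 2) <= t * (ld e f i - ld e f j) <= M * t ^ 2) by nra.
    apply Rabs_le. lra.
Qed.

(** Bounding [F] by its first order Taylor polynomial up to a square is a form
    of [F' = G] that passes to pointwise limits. *)
Definition taylor1 (M : R) (F G : R -> R) : Prop :=
  forall x y, Rabs (F y - F x - (y - x) * G x) <= M * (y - x) ^ 2.

Section Passage.

Context (U : (nat -> Prop) -> Prop) {PU : ProperFilter U}.
Context (e : nat -> R) (i0 : nat -> Z).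
Context (He : forall n, 0 < e n) (Helim : ulim U e 0).

(** The shift [i0 n] allows the limit to be centred at a point where [w > 0]. *)
Definition node (n : nat) (x : R) : Z := (i0 n + Int_part (x / e n))%Z.

Lemma node_displacement n x y :
  Rabs (e n * IZR (node n y - node n x) - (y - x)) <= e n.
Proof.
  unfold node. specialize (He n).
  replace (i0 n + Int_part (y / e n) - (i0 n + Int_part (x / e n)))%Z
    with (Int_part (y / e n) - Int_part (x / e n))%Z by lia.
  rewrite minus_IZR.
  destruct (base_Int_part (x / e n)) as [X1 X2].
  destruct (base_Int_part (y / e n)) as [Y1 Y2].
  assert (Ex : e n * (x / e n) = x) by (field; lra).
  assert (Ey : e n * (y / e n) = y) by (field; lra).
  apply Rabs_le. nra.
Qed.

Lemma node_displacement_ulim x y :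
  ulim U (fun n => e n * IZR (node n y - node n x)) (y - x).
Proof.
  assert (H : ulim U (fun n => e n * IZR (node n y - node n x) - (y - x)) 0).
  { apply (ulim_null_bound U _ e); [|exact Helim].
    apply filter_forall. intros n. apply node_displacement. }
  pose proof (ulim_plus U _ _ _ _ H (ulim_const U (y - x))) as H'.
  rewrite Rplus_0_l in H'.
  apply (ulim_ext U (fun n => e n * IZR (node n y - node n x) - (y - x) + (y - x)));
    [|exact H'].
  apply filter_forall. intros n. ring.
Qed.

Lemma taylor1_ulim M (f : nat -> Z -> R) (F G : R -> R) :
  (forall n i j, Rabs (ld (e n) (f n) j - ld (e n) (f n) i)
                 <= M * Rabs (e n * IZR (j - i))) ->
  (forall x, ulim U (fun n => f n (node n x)) (F x)) ->
  (forall x, ulim U (fun n => ld (e n) (f n) (node n x)) (G x)) ->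
  taylor1 (2 * M) F G.
Proof.
  intros Hf HF HG x y.
  pose proof (node_displacement_ulim x y) as Ht.
  apply (ulim_le U
    (fun n => Rabs (f n (node n y) - f n (node n x)
       - e n * IZR (node n y - node n x) * ld (e n) (f n) (node n x)))
    (fun n => 2 * M * (e n * IZR (node n y - node n x)) ^ 2)).
  - apply (ulim_Rabs U). apply (ulim_minus U); [apply (ulim_minus U); apply HF|].
    apply (ulim_mult U); [exact Ht | apply HG].
  - apply (ulim_mult U); [ulim | apply (ulim_pow U); exact Ht].
  - apply filter_forall. intros n. now apply lattice_taylor.
Qed.

(** The equation relates values at neighbouring lattice points; in the limit
    they coincide. *)
Lemma ulim_neighbour C (f : nat -> Z -> R) (j : Z) x l :
  (forall n i, Rabs (ld (e n) (f n) i) <= C) ->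
  ulim U (fun n => f n (node n x)) l ->
  ulim U (fun n => f n (node n x + j)%Z) l.
Proof.
  intros Hf Hl.
  assert (H : ulim U (fun n => f n (node n x + j)%Z - f n (node n x)) 0).
  { apply (ulim_null_bound U _ (fun n => C * Rabs (IZR j) * e n)).
    - apply filter_forall. intros n.
      eapply Rle_trans; [apply (lattice_lipschitz (e n) C); [apply He | apply Hf]|].
      replace (node n x + j - node n x)%Z with j by lia.
      rewrite Rabs_mult, (Rabs_pos_eq (e n)) by (apply Rlt_le, He). lra.
    - replace 0 with (C * Rabs (IZR j) * 0) by ring. ulim. }
  pose proof (ulim_plus U _ _ _ _ H Hl) as H'. rewrite Rplus_0_l in H'.
  apply (ulim_ext U (fun n => f n (node n x + j)%Z - f n (node n x) + f n (node n x)));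
    [|exact H'].
  apply filter_forall. intros n. ring.
Qed.

End Passage.

(** Partial sums counted from [j0], extended to all of [Z] so that the
    difference equation holds globally. *)
Lemma lattice_primitive_exists e f j0 :
  0 < e -> exists S : Z -> R, (forall i, ld e S i = f i) /\
    forall n, S (j0 + Z.of_nat n)%Z = e * psum (fun i => f (i + j0)%Z) n.
Proof.
  intros He.
  exists (fun j => if Z_le_gt_dec j0 j
    then e * psum (fun i => f (i + j0)%Z) (Z.to_nat (j - j0))
    else - (e * psum (fun i => f (j0 - 1 - i)%Z) (Z.to_nat (j0 - j)))).
  split.
  - intros i. unfold ld.
    destruct (Z_le_gt_dec j0 (i + 1)) as [H1|H1], (Z_le_gt_dec j0 i) as [H2|H2];
      try lia.
    + replace (Z.to_nat (i + 1 - j0)) with (S (Z.to_nat (i - j0))) by lia.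
      cbn [psum].
      replace (Z.of_nat (Z.to_nat (i - j0)) + j0)%Z with i by lia. field. lra.
    + replace (Z.to_nat (i + 1 - j0)) with 0%nat by lia.
      replace (Z.to_nat (j0 - i)) with 1%nat by lia. cbn [psum].
      replace (j0 - 1 - Z.of_nat 0)%Z with i by lia. field. lra.
    + replace (Z.to_nat (j0 - i)) with (S (Z.to_nat (j0 - (i + 1)))) by lia.
      cbn [psum].
      replace (j0 - 1 - Z.of_nat (Z.to_nat (j0 - (i + 1))))%Z with i by lia.
      field. lra.
  - intros n. destruct (Z_le_gt_dec j0 (j0 + Z.of_nat n)) as [H|H]; [|lia].
    do 2 f_equal. lia.
Qed.

Lemma Rmax0_lipschitz x y : Rabs (Rmax x 0 - Rmax y 0) <= Rabs (x - y).
Proof.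
  unfold Rmax, Rabs. repeat destruct Rle_dec; repeat destruct Rcase_abs; lra.
Qed.

(** The function [I] is the limit of the partial sums of [v ^ 2]; its bound
    [C] is the energy bound over a whole period, which contains every bounded
    interval eventually, and carries the square integrability of [V0]. *)
Lemma homoclinic_profile sigma a b beta :
  0 < sigma -> sigma ^ 2 < a -> 0 < b < a -> 0 <= beta <= 1 ->
  beta ^ 2 * b + b / 2 + 3 / 8 * (a - b) * (1 - beta) ^ 2 < sigma ^ 2 / 2 ->
  exists (V0 V1 V2 V3 I : R -> R) (h M C : R),
    0 < h /\ h <= (a - b) * V0 0 /\
    taylor1 M V0 V1 /\ taylor1 M V1 V2 /\ taylor1 M V2 V3 /\
    taylor1 M V3 (fun x => Rmax ((a - b) * V0 x - h) 0
                           - 2 * sigma * V2 x - a * V0 x) /\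
    taylor1 M I (fun x => V0 x ^ 2) /\
    (forall x y, x <= y -> I x <= I y) /\ (forall x, 0 <= I x <= C).
Proof.
  intros Hsigma Ha Hb Hbeta Hneg.
  destruct (lattice_solutions_exist sigma a b beta Hsigma Ha Hb Hbeta Hneg)
    as (h0 & C & L & e1 & Hh0 & HC & He1 & Hsol).
  set (k := a - b) in *. set (kappa := a - sigma ^ 2) in *.
  assert (Hk : 0 < k) by (unfold k; lra).
  set (n0 := Z.to_nat (up (/ e1 + Rabs L))).
  set (p := fun n : nat => (n + n0 + 1)%nat).
  assert (Hp : forall n, / e1 <= INR (p n) /\ L <= INR (p n) /\ 1 <= INR (p n)
                         /\ INR n <= INR (p n)).
  { intros n. pose proof (Rinv_0_lt_compat e1 He1). pose proof (Rabs_pos L).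
    pose proof (Rle_abs L).
    destruct (up_to_nat (/ e1 + Rabs L)) as [Hn0 _]; [lra|]. fold n0 in Hn0.
    unfold p. rewrite !plus_INR. simpl. pose proof (pos_INR n). lra. }
  set (e := fun n : nat => / INR (p n)).
  set (N := fun n : nat => (2 * (p n * p n))%nat).
  assert (He : forall n, 0 < e n).
  { intros n. apply Rinv_0_lt_compat. destruct (Hp n) as (_ & _ & H & _). lra. }
  assert (HeN : forall n, INR (N n) * e n = 2 * INR (p n)).
  { intros n. unfold N, e. rewrite !mult_INR. simpl.
    destruct (Hp n) as (_ & _ & H & _). field. lra. }
  assert (Hall : forall n, exists s : (Z -> R) * (Z -> R) * R * Z,
    let '(w, v, h, i0) := s in
    lattice_solution (e n) sigma kappa k h (N n) w v /\
    h0 <= h <= C /\ h <= k * v i0 /\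
    lint (e n) (N n) (fun i => v i ^ 2) <= C /\
    forall i, Rabs (v i) <= C /\ Rabs (ld (e n) v i) <= C /\
      Rabs (ld (e n) (ld (e n) v) i) <= C /\
      Rabs (ld (e n) (ld (e n) (ld (e n) v)) i) <= C /\
      Rabs (ld (e n) (ld (e n) (ld (e n) (ld (e n) v))) i) <= C).
  { intros n. destruct (Hp n) as (P1 & P2 & P3 & P4).
    destruct (Hsol (e n) (N n)) as (w & v & h & i0 & H).
    - split; [apply He|]. unfold e. rewrite <- (Rinv_inv e1).
      apply Rinv_le_contravar; [now apply Rinv_0_lt_compat | assumption].
    - rewrite HeN. lra.
    - now exists (w, v, h, i0). }
  clear Hsol. apply functional_choice in Hall. destruct Hall as [s Hs].
  set (w := fun n => fst (fst (fst (s n)))).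
  set (v := fun n => snd (fst (fst (s n)))).
  set (hh := fun n => snd (fst (s n))).
  set (i0 := fun n => snd (s n)).
  assert (Hs' : forall n,
    lattice_solution (e n) sigma kappa k (hh n) (N n) (w n) (v n) /\
    h0 <= hh n <= C /\ hh n <= k * v n (i0 n) /\
    lint (e n) (N n) (fun i => v n i ^ 2) <= C /\
    forall i, Rabs (v n i) <= C /\ Rabs (ld (e n) (v n) i) <= C /\
      Rabs (ld (e n) (ld (e n) (v n)) i) <= C /\
      Rabs (ld (e n) (ld (e n) (ld (e n) (v n))) i) <= C /\
      Rabs (ld (e n) (ld (e n) (ld (e n) (ld (e n) (v n)))) i) <= C).
  { intros n. specialize (Hs n). unfold w, v, hh, i0.
    destruct (s n) as [[[w' v'] h'] i']. exact Hs. }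
  clear Hs. clearbody w v hh i0. clear s.
  destruct free_ultrafilter as (U & PU & ultra & Hev).
  assert (Helim : ulim U e 0).
  { apply ulim_lim_seq; [assumption|]. unfold e, p.
    apply (is_lim_seq_ext (fun n => / INR (n + (n0 + 1)))).
    - intros n. now rewrite Nat.add_assoc.
    - apply (is_lim_seq_incr_n (fun n => / INR n) (n0 + 1)).
      apply (is_lim_seq_inv INR p_infty); [apply is_lim_seq_INR | discriminate]. }
  set (nd := node e i0).
  assert (Hlim : forall f : nat -> Z -> R, (forall n i, Rabs (f n i) <= C) ->
     exists F : R -> R, forall x, ulim U (fun n => f n (nd n x)) (F x)).
  { intros f Hf. apply (functional_choice (fun x l => ulim U (fun n => f n (nd n x)) l)).
    intros x. apply (ulim_exists U _ C ultra). now apply filter_forall. }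
  assert (B0 : forall n i, Rabs (v n i) <= C) by (intros n i; apply (Hs' n)).
  assert (B1 : forall n i, Rabs (ld (e n) (v n) i) <= C) by (intros n i; apply (Hs' n)).
  assert (B2 : forall n i, Rabs (ld (e n) (ld (e n) (v n)) i) <= C)
    by (intros n i; apply (Hs' n)).
  assert (B3 : forall n i, Rabs (ld (e n) (ld (e n) (ld (e n) (v n))) i) <= C)
    by (intros n i; apply (Hs' n)).
  assert (B4 : forall n i, Rabs (ld (e n) (ld (e n) (ld (e n) (ld (e n) (v n)))) i) <= C)
    by (intros n i; apply (Hs' n)).
  destruct (Hlim v B0) as [V0 HV0].
  destruct (Hlim _ B1) as [V1 HV1].
  destruct (Hlim _ B2) as [V2 HV2].
  destruct (Hlim _ B3) as [V3 HV3].
  destruct (ulim_exists U hh C ultra) as [h Hh].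
  { apply filter_forall. intros n. destruct (Hs' n) as (_ & H & _).
    rewrite Rabs_pos_eq; lra. }
  (* primitives of [v ^ 2], starting half a period to the left of [i0] *)
  assert (Hprim : forall n, exists S : Z -> R,
    (forall i, ld (e n) S i = v n i ^ 2) /\
    forall m, S (i0 n - Z.of_nat (p n * p n) + Z.of_nat m)%Z
      = e n * psum (fun i => v n (i + (i0 n - Z.of_nat (p n * p n)))%Z ^ 2) m).
  { intros n. now apply (lattice_primitive_exists (e n) (fun i => v n i ^ 2)). }
  apply functional_choice in Hprim. destruct Hprim as [S HS].
  assert (HSb : forall x, U (fun n => 0 <= S n (nd n x) <= C)).
  { intros x. apply Hev. exists (Z.to_nat (up (Rabs x + 1))). intros n Hn.
    assert (Hx : Rabs x + 1 <= INR (p n)).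
    { destruct (up_to_nat (Rabs x + 1)) as [H1 _]; [pose proof (Rabs_pos x); lra|].
      apply le_INR in Hn. destruct (Hp n) as (_ & _ & _ & H). lra. }
    assert (Hq : Rabs (IZR (Int_part (x / e n))) <= INR (p n * p n)).
    { rewrite mult_INR. destruct (base_Int_part (x / e n)) as [X1 X2].
      assert (Ex : x / e n = x * INR (p n)).
      { unfold e. destruct (Hp n) as (_ & _ & H & _). field. lra. }
      rewrite Ex in *. destruct (Hp n) as (_ & _ & H & _).
      assert (Hx' := Rle_abs x). assert (Hx'' := Rle_abs (- x)).
      rewrite Rabs_Ropp in Hx''. apply Rabs_le. nra. }
    rewrite INR_IZR_INZ in Hq. apply Rabs_le_between in Hq.
    destruct Hq as [Q1 Q2]. rewrite <- opp_IZR in Q1.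
    apply le_IZR in Q1. apply le_IZR in Q2.
    unfold nd, node.
    set (m := Z.to_nat (Int_part (x / e n) + Z.of_nat (p n * p n))).
    replace (i0 n + Int_part (x / e n))%Z
      with (i0 n - Z.of_nat (p n * p n) + Z.of_nat m)%Z by (unfold m; lia).
    rewrite (proj2 (HS n)). specialize (He n).
    destruct (Hs' n) as ([(_ & _ & _ & Hv) _] & _ & _ & Hv2 & _).
    split.
    - apply Rmult_le_pos; [lra|]. apply psum_nonneg. intros; apply pow2_ge_0.
    - apply Rle_trans with (2 := Hv2). unfold lint.
      apply Rmult_le_compat_l; [lra|].
      rewrite <- (psum_periodic_shift (N n) (fun i => v n i ^ 2)
                    (i0 n - Z.of_nat (p n * p n))).
      + apply psum_mono; [intros; apply pow2_ge_0 |]. unfold m, N. lia.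
      + now apply (periodic_map (N n) (fun x => x ^ 2)). }
  assert (HI : exists I : R -> R, forall x, ulim U (fun n => S n (nd n x)) (I x)).
  { apply (functional_choice (fun x l => ulim U (fun n => S n (nd n x)) l)).
    intros x. apply (ulim_exists U _ C ultra). generalize (HSb x).
    apply filter_imp. intros n H. rewrite Rabs_pos_eq; lra. }
  destruct HI as [I HI].
  set (M4 := k * C + 2 * sigma * C + a * C).
  assert (Hs2 : 0 < sigma ^ 2) by now apply pow_lt.
  assert (HM4 : 0 <= M4).
  { unfold M4. assert (0 <= k * C) by nra. assert (0 <= sigma * C) by nra.
    assert (0 <= a * C) by nra. lra. }
  pose proof (pow2_ge_0 C) as HC2.
  assert (Hmono : forall M M' F G, M <= M' -> taylor1 M F G -> taylor1 M' F G).
  { intros M M' F G HM H x y. apply Rle_trans with (1 := H x y).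
    apply Rmult_le_compat_r; [apply pow2_ge_0 | assumption]. }
  exists V0, V1, V2, V3, I, h, (2 * (C + M4 + 2 * C ^ 2)), C.
  split; [|split; [|split; [|split; [|split; [|split; [|split; [|split]]]]]]].
  - apply Rlt_le_trans with h0; [assumption|].
    apply (ulim_le U (fun _ => h0) hh); [ulim | assumption |].
    apply filter_forall. intros n. apply (Hs' n).
  - apply (ulim_le U hh (fun n => k * v n (nd n 0))); [assumption | |].
    + apply (ulim_mult U); [ulim | apply HV0].
    + apply filter_forall. intros n. unfold nd, node.
      assert (E : Int_part (0 / e n) = 0%Z).
      { unfold Rdiv. rewrite Rmult_0_l. symmetry. apply Int_part_spec. lra. }
      rewrite E, Z.add_0_r. apply (Hs' n).
  - apply (Hmono (2 * C)); [lra|].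
    apply (taylor1_ulim U e i0 He Helim C v); [|exact HV0 | exact HV1].
    intros n. apply lattice_lipschitz; [apply He | apply B2].
  - apply (Hmono (2 * C)); [lra|].
    apply (taylor1_ulim U e i0 He Helim C (fun n => ld (e n) (v n)));
      [|exact HV1 | exact HV2].
    intros n. apply lattice_lipschitz; [apply He | apply B3].
  - apply (Hmono (2 * C)); [lra|].
    apply (taylor1_ulim U e i0 He Helim C (fun n => ld (e n) (ld (e n) (v n))));
      [|exact HV2 | exact HV3].
    intros n. apply lattice_lipschitz; [apply He | apply B4].
  - assert (H4 : forall n i, ld (e n) (ld (e n) (ld (e n) (ld (e n) (v n)))) i
      = Rmax (k * v n (i + 2)%Z - hh n) 0
        - 2 * sigma * ld (e n) (ld (e n) (v n)) (i + 1)%Z - a * v n (i + 2)%Z).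
    { intros n i. destruct (Hs' n) as ([Hadm [Hr Hc]] & _).
      rewrite (lattice_fourth_difference (e n) sigma kappa (w n) (v n) (He n) Hr).
      rewrite Hc. unfold kappa. ring. }
    apply (Hmono (2 * M4)); [lra|].
    apply (taylor1_ulim U e i0 He Helim M4
             (fun n => ld (e n) (ld (e n) (ld (e n) (v n))))); [|exact HV3|].
    + intros n i j. rewrite !H4.
      pose proof (lattice_lipschitz (e n) C (v n) (He n) (B1 n) (i + 2) (j + 2)) as L0.
      pose proof (lattice_lipschitz (e n) C _ (He n) (B3 n) (i + 1) (j + 1)) as L2.
      replace (j + 2 - (i + 2))%Z with (j - i)%Z in L0 by lia.
      replace (j + 1 - (i + 1))%Z with (j - i)%Z in L2 by lia.
      pose proof (Rmax0_lipschitz (k * v n (j + 2)%Z - hh n)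
                    (k * v n (i + 2)%Z - hh n)) as Lm.
      replace (k * v n (j + 2)%Z - hh n - (k * v n (i + 2)%Z - hh n))
        with (k * (v n (j + 2)%Z - v n (i + 2)%Z)) in Lm by ring.
      rewrite Rabs_mult, (Rabs_pos_eq k) in Lm by lra.
      set (t := Rabs (e n * IZR (j - i))) in *.
      set (x2 := ld (e n) (ld (e n) (v n)) (j + 1)%Z) in *.
      set (y2 := ld (e n) (ld (e n) (v n)) (i + 1)%Z) in *.
      set (x0 := v n (j + 2)%Z) in *. set (y0 := v n (i + 2)%Z) in *.
      assert (Lk : k * Rabs (x0 - y0) <= k * (C * t)) by (apply Rmult_le_compat_l; lra).
      apply Rabs_le_between in L0. apply Rabs_le_between in L2.
      assert (Lm' := Rle_trans _ _ _ Lm Lk). apply Rabs_le_between in Lm'.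
      assert (- (sigma * (C * t)) <= sigma * (x2 - y2) <= sigma * (C * t)) by nra.
      assert (- (a * (C * t)) <= a * (x0 - y0) <= a * (C * t)) by nra.
      unfold M4. apply Rabs_le. lra.
    + intros x.
      apply (ulim_ext U (fun n => Rmax (k * v n (nd n x + 2)%Z - hh n) 0
        - 2 * sigma * ld (e n) (ld (e n) (v n)) (nd n x + 1)%Z
        - a * v n (nd n x + 2)%Z)).
      { apply filter_forall. intros n. symmetry. apply H4. }
      pose proof (ulim_neighbour U e i0 He Helim C v 2 x _ B1 (HV0 x)) as N0.
      pose proof (ulim_neighbour U e i0 He Helim C _ 1 x _ B3 (HV2 x)) as N2.
      fold nd in N0, N2. ulim.
  - apply (Hmono (2 * (2 * C ^ 2))); [lra|].
    apply (taylor1_ulim U e i0 He Helim (2 * C ^ 2) S); [|exact HI|].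
    + intros n i j. rewrite !(proj1 (HS n)).
      pose proof (lattice_lipschitz (e n) C (v n) (He n) (B1 n) i j) as L0.
      replace (v n j ^ 2 - v n i ^ 2) with ((v n j - v n i) * (v n j + v n i)) by ring.
      rewrite Rabs_mult.
      assert (Rabs (v n j + v n i) <= 2 * C).
      { eapply Rle_trans; [apply Rabs_triang|].
        pose proof (B0 n i). pose proof (B0 n j). lra. }
      replace (2 * C ^ 2 * Rabs (e n * IZR (j - i)))
        with (C * Rabs (e n * IZR (j - i)) * (2 * C)) by ring.
      apply Rmult_le_compat; try apply Rabs_pos; assumption.
    + intros x. apply (ulim_ext U (fun n => v n (nd n x) ^ 2)).
      * apply filter_forall. intros n. symmetry. apply (proj1 (HS n)).
      * apply (ulim_pow U), HV0.
  - intros x y Hxy.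
    apply (ulim_le U (fun n => S n (nd n x)) (fun n => S n (nd n y)));
      [apply HI | apply HI |].
    apply filter_forall. intros n.
    assert (Hnd : (nd n x <= nd n y)%Z).
    { unfold nd, node. apply Zplus_le_compat_l.
      destruct (base_Int_part (x / e n)) as [X1 X2].
      destruct (base_Int_part (y / e n)) as [Y1 Y2].
      assert (x / e n <= y / e n).
      { apply Rmult_le_compat_r; [apply Rlt_le, Rinv_0_lt_compat, He | assumption]. }
      apply Z.lt_succ_r, lt_IZR. unfold Z.succ. rewrite plus_IZR. lra. }
    assert (Hstep : forall i, S n i <= S n (i + 1)%Z).
    { intros i. pose proof (proj1 (HS n) i) as H. unfold ld in H.
      pose proof (pow2_ge_0 (v n i)) as H0. rewrite <- H in H0.
      specialize (He n). apply Rmult_le_compat_l with (r := e n) in H0; [|lra].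
      replace (e n * ((S n (i + 1)%Z - S n i) / e n)) with (S n (i + 1)%Z - S n i)
        in H0 by (field; lra). lra. }
    assert (Hup : forall m i, S n i <= S n (i + Z.of_nat m)%Z).
    { intros m i. induction m as [|m IH].
      - rewrite Z.add_0_r. lra.
      - apply Rle_trans with (1 := IH).
        replace (i + Z.of_nat (Datatypes.S m))%Z with (i + Z.of_nat m + 1)%Z by lia.
        apply Hstep. }
    specialize (Hup (Z.to_nat (nd n y - nd n x)) (nd n x)).
    rewrite Z2Nat.id in Hup by lia.
    now replace (nd n x + (nd n y - nd n x))%Z with (nd n y) in Hup by lia.
  - intros x. split.
    + apply (ulim_le U (fun _ => 0) (fun n => S n (nd n x))); [ulim | apply HI |].
      generalize (HSb x). apply filter_imp. intros n H; lra.
    + apply (ulim_le U (fun n => S n (nd n x)) (fun _ => C)); [apply HI | ulim |].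
      generalize (HSb x). apply filter_imp. intros n H; lra.
Qed.

(** * Regularity and decay of the profile *)

Lemma taylor1_is_derive M F G x : taylor1 M F G -> is_derive F x (G x).
Proof.
  intros H. apply is_derive_Reals. intros eps Heps.
  assert (Hd : 0 < eps / (Rabs M + 1)).
  { apply Rdiv_lt_0_compat; [lra|]. pose proof (Rabs_pos M). lra. }
  exists (mkposreal _ Hd). simpl. intros t Ht Htd.
  specialize (H x (x + t)). replace (x + t - x) with t in H by ring.
  assert (Habs : 0 < Rabs t) by now apply Rabs_pos_lt.
  replace ((F (x + t) - F x) / t - G x) with ((F (x + t) - F x - t * G x) / t)
    by (field; assumption).
  unfold Rdiv. rewrite Rabs_mult, Rabs_inv.
  apply Rmult_lt_reg_r with (Rabs t); [assumption|].
  rewrite Rmult_assoc, Rinv_l, Rmult_1_r by lra.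
  apply Rle_lt_trans with (1 := H). rewrite <- (pow2_abs t).
  pose proof (Rle_abs M). pose proof (Rabs_pos M).
  apply Rmult_lt_compat_l with (r := Rabs M + 1) in Htd; [|lra].
  replace ((Rabs M + 1) * (eps / (Rabs M + 1))) with eps in Htd by (field; lra).
  apply Rmult_lt_compat_r with (r := Rabs t) in Htd; [|assumption]. nra.
Qed.

Lemma taylor1_reflect M F G :
  taylor1 M F G -> taylor1 M (fun x => F (- x)) (fun x => - G (- x)).
Proof.
  intros H x y. specialize (H (- x) (- y)).
  replace (F (- y) - F (- x) - (y - x) * - G (- x))
    with (F (- y) - F (- x) - (- y - - x) * G (- x)) by ring.
  replace ((y - x) ^ 2) with ((- y - - x) ^ 2) by ring. exact H.
Qed.

Lemma is_lim_p_infty_spec f (l : R) :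
  is_lim f p_infty l <->
  forall eps, 0 < eps -> exists X, forall x, X < x -> Rabs (f x - l) < eps.
Proof.
  split.
  - intros H eps He. apply is_lim_spec in H. exact (H (mkposreal eps He)).
  - intros H. apply is_lim_spec. intros eps. exact (H eps (cond_pos eps)).
Qed.

Lemma is_lim_m_infty_reflect f (l : R) :
  is_lim (fun x => f (- x)) p_infty l -> is_lim f m_infty l.
Proof.
  intros H. apply is_lim_spec. intros eps.
  destruct (proj1 (is_lim_p_infty_spec _ _) H eps (cond_pos eps)) as [X HX].
  exists (- X). intros x Hx. specialize (HX (- x)).
  rewrite Ropp_involutive in HX. apply HX. lra.
Qed.

(** Barbalat: over a step of length proportional to [eps] the function moves
    by about the step times its slope, and these increments tend to zero. *)
Lemma taylor1_slope_vanishes M F G (l : R) :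
  taylor1 M F G -> is_lim F p_infty l -> is_lim G p_infty 0.
Proof.
  intros H HF. apply is_lim_p_infty_spec. intros eps He.
  pose proof (Rabs_pos M) as HM. pose proof (Rle_abs M) as HM'.
  set (t := eps / (4 * (Rabs M + 1))).
  assert (Ht : 0 < t) by (apply Rdiv_lt_0_compat; lra).
  assert (Ht4 : 4 * (Rabs M + 1) * t = eps) by (unfold t; field; lra).
  destruct (proj1 (is_lim_p_infty_spec _ _) HF (eps * t / 4)) as [X HX]; [nra|].
  exists X. intros x Hx. rewrite Rminus_0_r.
  pose proof (HX x Hx) as H1. pose proof (HX (x + t) ltac:(lra)) as H2.
  specialize (H x (x + t)). replace (x + t - x) with t in H by ring.
  apply Rabs_def2 in H1. apply Rabs_def2 in H2. apply Rabs_le_between in H.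
  assert (HMt : M * t ^ 2 <= eps * t / 4) by nra.
  apply Rabs_def1; apply Rmult_lt_reg_l with t; nra.
Qed.

Lemma taylor1_slope_vanishes_reflected M F G (l : R) :
  taylor1 M F G -> is_lim (fun x => F (- x)) p_infty l ->
  is_lim (fun x => G (- x)) p_infty 0.
Proof.
  intros H HF.
  pose proof (taylor1_slope_vanishes _ _ _ l (taylor1_reflect _ _ _ H) HF) as HG.
  apply is_lim_p_infty_spec. intros eps He.
  destruct (proj1 (is_lim_p_infty_spec _ _) HG eps He) as [X HX].
  exists X. intros x Hx. specialize (HX x Hx).
  rewrite Rminus_0_r in *. now rewrite Rabs_Ropp in HX.
Qed.

Lemma monotone_bounded_limit f B :
  (forall x y, x <= y -> f x <= f y) -> (forall x, f x <= B) ->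
  exists l : R, is_lim f p_infty l.
Proof.
  intros Hm Hb.
  destruct (completeness (fun r => exists x, r = f x)) as [l [Hub Hlub]].
  - exists B. intros r [x ->]. apply Hb.
  - now exists (f 0), 0.
  - exists l. apply is_lim_p_infty_spec. intros eps He.
    assert (Hx : exists x, l - eps < f x).
    { apply NNPP. intro Hno. assert (l <= l - eps); [|lra].
      apply Hlub. intros r [x ->]. apply Rnot_lt_le. intro.
      apply Hno. now exists x. }
    destruct Hx as [X HX]. exists X. intros x Hx.
    assert (f X <= f x) by (apply Hm; lra).
    assert (f x <= l) by (apply Hub; now exists x).
    apply Rabs_def1; lra.
Qed.

Lemma square_limit_zero f :
  is_lim (fun x => f x ^ 2) p_infty 0 -> is_lim f p_infty 0.
Proof.
  intros H. apply is_lim_p_infty_spec. intros eps He.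
  destruct (proj1 (is_lim_p_infty_spec _ _) H (eps ^ 2)) as [X HX]; [now apply pow_lt|].
  exists X. intros x Hx. specialize (HX x Hx).
  rewrite Rminus_0_r in *. rewrite Rabs_pos_eq in HX by apply pow2_ge_0.
  rewrite <- (pow2_abs (f x)) in HX. pose proof (Rabs_pos (f x)).
  apply Rnot_le_lt. intro. nra.
Qed.

(** Monotone and bounded, [I] has limits at both ends, so its slope [V ^ 2]
    vanishes there; then so does the slope of [V]. *)
Lemma square_integrable_decay M M' C V V' I :
  taylor1 M V V' -> taylor1 M' I (fun x => V x ^ 2) ->
  (forall x y, x <= y -> I x <= I y) -> (forall x, 0 <= I x <= C) ->
  lim_abs_infty V 0 /\ lim_abs_infty V' 0.
Proof.
  intros HV HI Hmono Hb.
  assert (Hp : is_lim V p_infty 0).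
  { destruct (monotone_bounded_limit I C Hmono (fun x => proj2 (Hb x))) as [l Hl].
    apply square_limit_zero. exact (taylor1_slope_vanishes _ _ _ l HI Hl). }
  assert (Hm : is_lim (fun x => V (- x)) p_infty 0).
  { destruct (monotone_bounded_limit (fun x => - I (- x)) 0) as [l Hl].
    - intros x y Hxy. specialize (Hmono (- y) (- x)). lra.
    - intros x. specialize (Hb (- x)). lra.
    - apply square_limit_zero.
      apply (taylor1_slope_vanishes_reflected M' I (fun x => V x ^ 2) (- l) HI).
      apply is_lim_opp in Hl.
      apply (is_lim_ext (fun x => - - I (- x))); [intros; ring | exact Hl]. }
  split; split.
  - exact Hp.
  - now apply is_lim_m_infty_reflect.
  - exact (taylor1_slope_vanishes _ _ _ 0 HV Hp).
  - apply is_lim_m_infty_reflect.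
    exact (taylor1_slope_vanishes_reflected _ _ _ 0 HV Hm).
Qed.

(** * Travelling waves *)

Definition derivative_chain (n : nat) (D : nat -> R -> R) : Prop :=
  forall m, (m < n)%nat -> forall s, is_derive (D m) s (D (S m) s).

Lemma Derive_n_chain_affine n D p q :
  derivative_chain n D ->
  forall m, (m <= n)%nat -> forall x,
    Derive_n (fun z => D 0%nat (p * z + q)) m x = p ^ m * D m (p * x + q).
Proof.
  intros HD m. induction m as [|m IH]; intros Hm x.
  - simpl. ring.
  - cbn [Derive_n].
    rewrite (Derive_ext _ (fun z => p ^ m * D m (p * z + q)))
      by (intros z; apply IH; lia).
    apply is_derive_unique.
    replace (p ^ S m * D (S m) (p * x + q))
      with (p ^ m * (p * D (S m) (p * x + q))) by (simpl; ring).
    apply (is_derive_scal (fun z => D m (p * z + q))).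
    apply (is_derive_comp (D m) (fun z => p * z + q)).
    + apply HD. lia.
    + auto_derive; [exact Logic.I | ring].
Qed.

Lemma ex_derive_n_chain_affine n D p q :
  derivative_chain n D ->
  forall m, (m <= n)%nat -> forall x,
    ex_derive_n (fun z => D 0%nat (p * z + q)) m x.
Proof.
  intros HD [|m] Hm x; [exact Logic.I|].
  cbn [ex_derive_n].
  apply (ex_derive_ext (fun z => p ^ m * D m (p * z + q))).
  - intros z. symmetry. apply (Derive_n_chain_affine n); [assumption | lia].
  - apply (ex_derive_scal (fun z => D m (p * z + q))).
    apply (ex_derive_comp (D m) (fun z => p * z + q)).
    + exists (D (S m) (p * x + q)). apply HD. lia.
    + auto_derive. exact Logic.I.
Qed.

Lemma continuity_2d_wave (f : R -> R) c x t :
  continuous f (x - c * t) -> continuity_2d_pt (fun x t => f (x - c * t)) x t.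
Proof.
  intros Hf eps.
  destruct (proj1 (filterlim_locally _ _) Hf eps) as [d Hd].
  pose proof (Rabs_pos c) as Hc.
  assert (Hd' : 0 < d / (1 + Rabs c)) by (apply Rdiv_lt_0_compat; [apply cond_pos | lra]).
  exists (mkposreal _ Hd'). simpl. intros x' t' Hx Ht. apply Hd.
  change (Rabs ((x' - c * t') - (x - c * t)) < d).
  replace ((x' - c * t') - (x - c * t)) with ((x' - x) + - (c * (t' - t))) by ring.
  apply Rle_lt_trans with (1 := Rabs_triang _ _).
  rewrite Rabs_Ropp, Rabs_mult.
  replace (pos d) with (d / (1 + Rabs c) + Rabs c * (d / (1 + Rabs c)))
    by (field; lra).
  assert (Rabs c * Rabs (t' - t) <= Rabs c * (d / (1 + Rabs c)))
    by (apply Rmult_le_compat_l; lra). lra.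
Qed.

Lemma lim_abs_infty_shift f l d :
  lim_abs_infty f l -> lim_abs_infty (fun x => f (x - d)) l.
Proof.
  intros [Hp Hm]. apply is_lim_spec in Hp. apply is_lim_spec in Hm.
  split; apply is_lim_spec; intros eps.
  - destruct (Hp eps) as [X HX]. exists (X + d). intros x Hx. apply HX. lra.
  - destruct (Hm eps) as [X HX]. exists (X + d). intros x Hx. apply HX. lra.
Qed.

Lemma continuity_2d_pt_ext f g x t :
  (forall x t, f x t = g x t) -> continuity_2d_pt f x t -> continuity_2d_pt g x t.
Proof.
  intros E H eps. destruct (H eps) as [d Hd]. exists d. intros x' t' Hx Ht.
  rewrite <- !E. now apply Hd.
Qed.

Lemma profile_gives_wave a b c D :
  derivative_chain 4 D -> (forall s, continuous (D 4%nat) s) ->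
  (forall s, c ^ 2 * D 2%nat s + D 4%nat s + a * pos_part (D 0%nat s)
             - b * neg_part (D 0%nat s) = 1) ->
  lim_abs_infty (D 0%nat) (1 / a) -> lim_abs_infty (D 1%nat) 0 ->
  (exists s, D 0%nat s <> 1 / a) ->
  travelling_wave_solution a b c (fun x t => D 0%nat (x - c * t)).
Proof.
  intros HD H4 Hode Hlim0 Hlim1 Hnt.
  assert (Hcont : forall m, (m <= 4)%nat -> forall s, continuous (D m) s).
  { intros m Hm s. destruct (Nat.eq_dec m 4) as [->|Hne]; [apply H4|].
    apply (ex_derive_continuous (D m)). exists (D (S m) s). apply HD. lia. }
  set (u := fun x t => D 0%nat (x - c * t)).
  assert (Hx : forall m, (m <= 4)%nat -> forall x t,
            d_x m u x t = D m (x - c * t) /\ ex_derive_n (fun z => u z t) m x).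
  { intros m Hm x t. unfold d_x, u.
    assert (E : forall z, D 0%nat (1 * z + - (c * t)) = D 0%nat (z - c * t))
      by (intros; f_equal; ring).
    split.
    - rewrite <- (Derive_n_ext _ _ m x E), (Derive_n_chain_affine 4) by assumption.
      rewrite pow1, Rmult_1_l. f_equal. ring.
    - apply (ex_derive_n_ext _ _ m x E).
      now apply (ex_derive_n_chain_affine 4). }
  assert (Ht : forall m, (m <= 2)%nat -> forall x t,
            d_t m u x t = (- c) ^ m * D m (x - c * t)
            /\ ex_derive_n (fun z => u x z) m t).
  { intros m Hm x t. unfold d_t, u.
    assert (E : forall z, D 0%nat (- c * z + x) = D 0%nat (x - c * z))
      by (intros; f_equal; ring).
    split.
    - rewrite <- (Derive_n_ext _ _ m t E), (Derive_n_chain_affine 4)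
        by (assumption || lia).
      f_equal. f_equal. ring.
    - apply (ex_derive_n_ext _ _ m t E).
      apply (ex_derive_n_chain_affine 4); [assumption | lia]. }
  split; [split; [|split]|].
  - intros x t _. split; intros m Hm; split.
    + now apply Hx.
    + apply (continuity_2d_pt_ext (fun x t => D m (x - c * t))).
      * intros; symmetry; now apply Hx.
      * apply continuity_2d_wave. now apply Hcont.
    + now apply Ht.
    + apply (continuity_2d_pt_ext (fun x t => (- c) ^ m * D m (x - c * t))).
      * intros; symmetry; now apply Ht.
      * apply (continuity_2d_wave (fun s => (- c) ^ m * D m s)).
        apply (continuous_scal_r ((- c) ^ m) (D m)). apply Hcont. lia.
  - intros x t _. rewrite (proj1 (Ht 2%nat ltac:(lia) x t)).
    rewrite (proj1 (Hx 4%nat ltac:(lia) x t)).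
    specialize (Hode (x - c * t)). unfold u.
    replace ((- c) ^ 2) with (c ^ 2) by ring. exact Hode.
  - intros t _. split.
    + now apply (lim_abs_infty_shift (D 0%nat)).
    + destruct (lim_abs_infty_shift (D 1%nat) 0 (c * t) Hlim1) as [Hp Hm].
      split; eapply is_lim_ext; try eassumption;
        intros x; symmetry; now apply (Hx 1%nat ltac:(lia)).
  - exists (D 0%nat). split; [reflexivity | assumption].
Qed.

Lemma lim_abs_infty_affine f p q :
  lim_abs_infty f 0 -> lim_abs_infty (fun x => p + q * f x) p.
Proof.
  intros [H1 H2].
  unfold lim_abs_infty. replace (Finite p) with (Finite (p + q * 0)) by (f_equal; ring).
  split; apply is_lim_plus'; try apply is_lim_const;
    change (Finite (q * 0)) with (Rbar_mult q 0);
    apply (is_lim_scal_l f q); assumption.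
Qed.

Lemma travelling_wave_exists sigma a b c beta :
  0 < sigma -> c ^ 2 = 2 * sigma -> sigma ^ 2 < a -> 0 < b < a ->
  0 <= beta <= 1 ->
  beta ^ 2 * b + b / 2 + 3 / 8 * (a - b) * (1 - beta) ^ 2 < sigma ^ 2 / 2 ->
  exists u, travelling_wave_solution a b c u.
Proof.
  intros Hsigma Hc Ha Hb Hbeta Hneg.
  destruct (homoclinic_profile sigma a b beta Hsigma Ha Hb Hbeta Hneg)
    as (V0 & V1 & V2 & V3 & I & h & M & C & Hh & H0 & T0 & T1 & T2 & T3 & TI & Hm & HI).
  set (k := a - b) in *. assert (Hk : 0 < k) by (unfold k; lra).
  assert (Ha0 : 0 < a) by lra.
  set (V4 := fun x => Rmax (k * V0 x - h) 0 - 2 * sigma * V2 x - a * V0 x) in *.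
  destruct (square_integrable_decay M M C V0 V1 I T0 TI Hm HI) as [L0 L1].
  set (theta := k / (a * h)).
  assert (Htheta : 0 < theta) by (apply Rdiv_lt_0_compat; nra).
  set (D := fun m : nat => match m with
    | O => fun s => 1 / a + - theta * V0 s
    | S O => fun s => 0 + - theta * V1 s
    | S (S O) => fun s => - theta * V2 s
    | S (S (S O)) => fun s => - theta * V3 s
    | _ => fun s => - theta * V4 s
    end).
  assert (Hder : forall F G s, taylor1 M F G ->
            is_derive (fun s => - theta * F s) s (- theta * G s)).
  { intros F G s HT. apply is_derive_scal. now apply (taylor1_is_derive M). }
  assert (Hcont : forall F G s, taylor1 M F G -> continuous F s).
  { intros F G s HT. apply (ex_derive_continuous F). exists (G s).
    now apply (taylor1_is_derive M). }
  exists (fun x t => D 0%nat (x - c * t)).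
  apply profile_gives_wave.
  - intros m Hm4 s. destruct m as [|[|[|[|m]]]]; [| | | | lia]; simpl.
    + apply (is_derive_plus (fun _ => 1 / a) (fun s => - theta * V0 s)).
      * apply @is_derive_const.
      * now apply Hder.
    + replace (- theta * V2 s) with (0 + - theta * V2 s) by ring.
      apply (is_derive_plus (fun _ => 0) (fun s => - theta * V1 s)).
      * apply @is_derive_const.
      * now apply Hder.
    + now apply Hder.
    + now apply Hder.
  - intros s. simpl.
    apply (continuous_scal_r (- theta) V4). unfold V4.
    assert (C0 : continuous V0 s) by now apply (Hcont V0 V1).
    assert (C2 : continuous V2 s) by now apply (Hcont V2 V3).
    apply (continuous_minus (fun x => Rmax (k * V0 x - h) 0 - 2 * sigma * V2 x)
             (fun x => a * V0 x));
      [apply (continuous_minus (fun x => Rmax (k * V0 x - h) 0)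
                (fun x => 2 * sigma * V2 x))|].
    + apply (continuous_comp (fun x => k * V0 x - h) (fun y => Rmax y 0)).
      * apply (continuous_minus (fun x => k * V0 x) (fun _ => h)).
        -- now apply (continuous_scal_r k V0).
        -- apply continuous_const.
      * intros Q [eps HQ]. exists eps. intros y Hy. apply HQ.
        apply Rle_lt_trans with (2 := Hy). apply Rmax0_lipschitz.
    + now apply (continuous_scal_r (2 * sigma) V2).
    + now apply (continuous_scal_r a V0).
  - intros s. simpl D. rewrite Hc. unfold pos_part, neg_part, V4.
    (* the scaling factor [theta] moves the kink of the profile equation to the
       level at which the displacement vanishes *)
    assert (E : Rmax (- (1 / a + - theta * V0 s)) 0
                = theta / k * Rmax (k * V0 s - h) 0).
    { replace (- (1 / a + - theta * V0 s)) with (theta / k * (k * V0 s - h))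
        by (unfold theta; field; repeat split; lra).
      assert (0 < theta / k) by now apply Rdiv_lt_0_compat.
      unfold Rmax. destruct (Rle_dec (theta / k * (k * V0 s - h)) 0),
        (Rle_dec (k * V0 s - h) 0); nra. }
    assert (E' : Rmax (1 / a + - theta * V0 s) 0
       = 1 / a + - theta * V0 s + Rmax (- (1 / a + - theta * V0 s)) 0).
    { unfold Rmax. do 2 destruct Rle_dec; lra. }
    rewrite E', E. unfold k. field. unfold k in Hk. lra.
  - now apply (lim_abs_infty_affine V0).
  - now apply (lim_abs_infty_affine V1).
  - exists 0. simpl. assert (0 < V0 0) by nra. nra.
Qed.

(** By the inequality of the arithmetic and geometric means
    [125 y <= (y + 125 / 4) ^ 2] with [y = 18 alpha + 5], which removes the
    square root and leaves a cubic inequality. *)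
Lemma P_bound alpha : 1 < alpha -> (9 * alpha - 5) * P alpha < 3 * alpha.
Proof.
  intros H. unfold P.
  assert (Hs : sqrt (125 * (18 * alpha + 5) ^ 3)
               <= (18 * alpha + 5) * (18 * alpha + 5 + 125 / 4)).
  { rewrite <- (sqrt_pow2 ((18 * alpha + 5) * (18 * alpha + 5 + 125 / 4))) by nra.
    apply sqrt_le_1_alt. set (y := 18 * alpha + 5).
    replace (125 * y ^ 3) with (y ^ 2 * (125 * y)) by ring.
    replace ((y * (y + 125 / 4)) ^ 2) with (y ^ 2 * (y + 125 / 4) ^ 2) by ring.
    apply Rmult_le_compat_l; [apply pow2_ge_0|].
    pose proof (pow2_ge_0 (y - 125 / 4)). nra. }
  assert (Ha2 : 0 < 2916 * alpha ^ 2) by (pose proof (pow_lt alpha 2); lra).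
  apply Rmult_lt_reg_r with (2916 * alpha ^ 2); [assumption|].
  unfold Rdiv at 1.
  replace ((9 * alpha - 5) * ((675 * alpha + 125 + sqrt (125 * (18 * alpha + 5) ^ 3))
     * / (2916 * alpha ^ 2)) * (2916 * alpha ^ 2))
    with ((9 * alpha - 5) * (675 * alpha + 125 + sqrt (125 * (18 * alpha + 5) ^ 3)))
    by (field; lra).
  apply Rle_lt_trans with ((9 * alpha - 5) * (675 * alpha + 125
     + (18 * alpha + 5) * (18 * alpha + 5 + 125 / 4))).
  - apply Rmult_le_compat_l; lra.
  - set (t := alpha - 1). replace alpha with (1 + t) by (unfold t; ring).
    assert (0 < t) by (unfold t; lra).
    assert (0 < t ^ 3) by now apply pow_lt.
    pose proof (pow2_ge_0 (t - 1 / 28)). nra.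
Qed.

Theorem theorem19 (c : R) (hc : c <> 0) (a b : R)
  (ha : c ^ 4 / 4 < a)
  (hb0 : 0 < b) (hb : b < c ^ 4 / 4 * P (4 * a / c ^ 4)) :
  exists u : R -> R -> R, travelling_wave_solution a b c u.
Proof.
  set (sigma := c ^ 2 / 2).
  assert (Hc2 : 0 < c ^ 2) by now apply pow2_gt_0.
  assert (Hsigma : 0 < sigma) by (unfold sigma; lra).
  assert (Hs2 : c ^ 4 / 4 = sigma ^ 2) by (unfold sigma; field).
  rewrite Hs2 in *.
  assert (Hs2' : 0 < sigma ^ 2) by now apply pow_lt.
  replace (4 * a / c ^ 4) with (a / sigma ^ 2) in hb
    by (unfold sigma; field; assumption).
  set (alpha := a / sigma ^ 2) in *.
  assert (Ealpha : alpha * sigma ^ 2 = a) by (unfold alpha; field; lra).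
  assert (Halpha : 1 < alpha) by nra.
  pose proof (P_bound alpha Halpha) as HP.
  assert (Hab : (9 * a - 5 * sigma ^ 2) * b < 3 * a * sigma ^ 2).
  { rewrite <- Ealpha. set (q := sigma ^ 2) in *.
    apply Rlt_trans with ((9 * alpha - 5) * q * (q * P alpha)).
    - replace (9 * (alpha * q) - 5 * q) with ((9 * alpha - 5) * q) by ring.
      apply Rmult_lt_compat_l; [nra | assumption].
    - replace ((9 * alpha - 5) * q * (q * P alpha))
        with (q * q * ((9 * alpha - 5) * P alpha)) by ring.
      replace (3 * (alpha * q) * q) with (q * q * (3 * alpha)) by ring.
      apply Rmult_lt_compat_l; nra. }
  assert (Hba : b < a) by nra.
  (* minimises the left-hand side of the energy condition over [beta] *)
  set (x := 8 * b / (5 * b + 3 * a)).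
  assert (Hx : (5 * b + 3 * a) * x = 8 * b) by (unfold x; field; lra).
  assert (Hx0 : 0 < x) by (unfold x; apply Rdiv_lt_0_compat; lra).
  apply (travelling_wave_exists sigma a b c (1 - x)); try assumption.
  - unfold sigma. field.
  - lra.
  - split; nra.
  - replace ((1 - x) ^ 2 * b + b / 2 + 3 / 8 * (a - b) * (1 - (1 - x)) ^ 2)
      with (3 / 2 * b - 2 * b * x + x * ((5 * b + 3 * a) * x) / 8) by field.
    rewrite Hx.
    apply Rmult_lt_reg_l with (2 * (5 * b + 3 * a)); [lra|].
    replace (2 * (5 * b + 3 * a) * (3 / 2 * b - 2 * b * x + x * (8 * b) / 8))
      with (3 * b * (5 * b + 3 * a) - 2 * b * ((5 * b + 3 * a) * x)) by field.
    rewrite Hx. nra.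
Qed.
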